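(* Consider an $\mathsf{NP}$-manifold of degree $2$ with local coordinates $x^\mu,\xi^a,p_\mu$ of degrees $0,1,2$ and symplectic form $\omega=dx^\mu\wedge dp_\mu+\frac12\kappa_{ab}\,d\xi^a\wedge d\xi^b$, where $\kappa$ is a constant, symmetric, invertible matrix. Let $\rho_a{}^\mu(x)$ and $T_{abc}(x)$ be smooth functions of $x$, with $T_{abc}$ totally skewsymmetric, such that $\mathscr H=\rho_a{}^\mu\,\xi^ap_\mu+\frac16T_{abc}\,\xi^a\xi^b\xi^c$ satisfies $\{\mathscr H,\mathscr H\}_\omega=0$. Define $$\dot\rho_a{}^\mu=\rho_b{}^\lambda\,\partial_\lambda\rho_a{}^\nu\,\partial_\nu\rho^{b|\mu}+\rho_b{}^\lambda\,\partial_\lambda\rho_c{}^\mu\,T_a{}^{bc},$$ $$\dot T_{abc}=\partial_\mu\rho_a{}^\nu\,\partial_\nu\rho_b{}^\lambda\,\partial_\lambda\rho_c{}^\mu-\partial_\mu\rho_a{}^\lambda\,\partial_\nu\rho_b{}^\mu\,\partial_\lambda\rho_c{}^\nu-T_a{}^{de}T_{bdf}T_{ce}{}^f+3\,\rho_d{}^\mu\,\partial_\mu\rho_{[a}{}^\nu\,\partial_\nu T_{bc]}{}^d+3\,\rho_d{}^\mu\,T_{[a}{}^{de}\,\partial_\mu T_{bc]e},$$ and $\dot{\mathscr H}=\dot\rho_a{}^\mu\,\xi^ap_\mu+\frac16\dot T_{abc}\,\xi^a\xi^b\xi^c$. Then $\{\mathscr H,\dot{\mathscr H}\}_\omega=0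$.
   Context: Repeated indices are summed; indices $a,b,\dots$ are raised and lowered with $\kappa_{ab}$ and its inverse $\kappa^{ab}$ (e.g. $\rho^{b|\mu}=\kappa^{bc}\rho_c{}^\mu$); $\partial_\mu=\partial/\partial x^\mu$. Square brackets of indices denote total skewsymmetrisation over the enclosed indices $a,b,c$ with weight one (i.e. divided by $3!$). Coordinates are graded commutative ($\xi^a$ odd, $x^\mu,p_\mu$ even). The Poisson bracket of degree $-2$ is, for $f$ homogeneous of degree $k$, $$\{f,g\}_\omega=\frac{\partial f}{\partial x^\mu}\frac{\partial g}{\partial p_\mu}-\frac{\partial f}{\partial p_\mu}\frac{\partial g}{\partial x^\mu}+(-1)^k\frac{\partial f}{\partial\xi^a}\kappa^{ab}\frac{\partial g}{\partial\xi^b}$$ (left derivatives). Solutions $\mathscr H$ of $\{\mathscr H,\mathscr H\}_\omega=0$ of degree $3$ correspond to Courant algebroid structures (in local components $(\rho,T)$) on the pseudo-Euclidean vector bundle with fibre metric $\kappa$. *)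

(* Defs.v *)
From HB Require Import structures.
From mathcomp Require Import all_boot all_order all_algebra.
From mathcomp Require Import ring.

Set Implicit Arguments.
Unset Strict Implicit.
Unset Printing Implicit Defensive.

Import Order.TTheory GRing.Theory Num.Theory.

Local Open Scope ring_scope.

(* [exterior A m] is the exterior algebra over A on generators xi_a, a < m.
   An element f stands for \sum_S f S * xi_S, where xi_S is the product of
   the xi_a, a \in S, in increasing order of a. *)
Definition exterior (A : comNzRingType) (m : nat) : Type :=
  {ffun {set 'I_m} -> A}.

HB.instance Definition _ (A : comNzRingType) (m : nat) :=
  GRing.Zmodule.on (exterior A m).

Section Exterior.
Variables (A : comNzRingType) (m : nat).
Implicit Types (f g h : exterior A m) (S V U W : {set 'I_m}) (a b : 'I_m).

Definition xicoef f S : A := (f : {ffun {set 'I_m} -> A}) S.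

Definition mk_ext (F : {set 'I_m} -> A) : exterior A m := [ffun S => F S].

(* xi_S * xi_V = (-1) ^+ inversions S V * xi_(S :|: V) for disjoint S, V *)
Definition inversions S V : nat :=
  (\sum_(a in S) \sum_(b in V) (b < a))%N.

Definition ext_one : exterior A m := mk_ext (fun S => (S == set0)%:R).

Definition ext_mul f g : exterior A m :=
  mk_ext (fun U => \sum_(S : {set 'I_m} | S \subset U)
    (-1) ^+ inversions S (U :\: S) * (xicoef f S * xicoef g (U :\: S))).

Lemma xicoef_mk F S : xicoef (mk_ext F) S = F S.
Proof. by rewrite /xicoef /mk_ext ffunE. Qed.

Lemma xicoefP f g : (forall S, xicoef f S = xicoef g S) -> f = g.
Proof. by move=> e; apply/ffunP => S; apply: e. Qed.

Lemma xicoefD f g S : xicoef (f + g) S = xicoef f S + xicoef g S.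
Proof. by rewrite /xicoef ffunE. Qed.

Lemma xicoefN f S : xicoef (- f) S = - xicoef f S.
Proof. by rewrite /xicoef ffunE. Qed.

Lemma xicoef0 S : xicoef 0 S = 0.
Proof. by rewrite /xicoef ffunE. Qed.

Lemma xicoef_sum I (r : seq I) (P : pred I) (F : I -> exterior A m) S :
  xicoef (\sum_(i <- r | P i) F i) S = \sum_(i <- r | P i) xicoef (F i) S.
Proof.
apply: (big_morph (fun f => xicoef f S)) => [f g|]; first exact: xicoefD.
exact: xicoef0.
Qed.

Lemma inversions0l V : inversions set0 V = 0%N.
Proof. by rewrite /inversions big_set0. Qed.

Lemma inversions0r V : inversions V set0 = 0%N.
Proof. by rewrite /inversions big1 // => a _; rewrite big_set0. Qed.

Lemma inversionsUl S V U : S \subset V ->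
  inversions V U = (inversions S U + inversions (V :\: S) U)%N.
Proof. by move=> /setIidPr e; rewrite /inversions (big_setID S) /= e. Qed.

Lemma inversionsUr S V U : S \subset V ->
  inversions U V = (inversions U S + inversions U (V :\: S))%N.
Proof.
move=> /setIidPr e; rewrite /inversions -big_split /=.
by apply: eq_bigr => a _; rewrite (big_setID S) /= e.
Qed.

Lemma ext_mulA : associative ext_mul.
Proof.
move=> f g h; apply: xicoefP => U; rewrite !xicoef_mk.
under eq_bigr do rewrite xicoef_mk !mulr_sumr.
under [RHS]eq_bigr do rewrite xicoef_mk mulr_suml mulr_sumr.
rewrite [RHS](exchange_big_dep (fun S => S \subset U)) /=; last first.
  by move=> V S VU SV; apply: subset_trans VU.
apply: eq_bigr => S SU.
rewrite [RHS](reindex_onto (fun W => S :|: W) (fun V => V :\: S)) /=; last first.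
  by move=> V /andP[_ SV]; rewrite -[RHS](setID V S) (setIidPr SV).
apply: eq_big => [W|W].
  rewrite subUset SU subsetUl andbT /= setDUl setDv set0U subsetD.
  congr andb; apply/idP/eqP => dWS; last exact/setDidPl.
  exact/setDidPl.
rewrite subsetD => /andP[WU dWS].
have SW : S \subset S :|: W by apply: subsetUl.
have eW : (S :|: W) :\: S = W.
  by rewrite setDUl setDv set0U; apply/setDidPl.
rewrite eW (inversionsUl _ SW) eW -setDDl.
have WUS : W \subset U :\: S by rewrite subsetD WU.
rewrite (inversionsUr _ WUS) !exprD.
by ring.
Qed.

Lemma ext_mul1l : left_id ext_one ext_mul.
Proof.
move=> f; apply: xicoefP => U; rewrite xicoef_mk (bigD1 set0) ?sub0set //=.
rewrite xicoef_mk eqxx mul1r inversions0l mul1r setD0.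
by rewrite big1 ?addr0 // => S /andP[_ /negPf S0]; rewrite xicoef_mk S0 mul0r mulr0.
Qed.

Lemma ext_mul1r : right_id ext_one ext_mul.
Proof.
move=> f; apply: xicoefP => U; rewrite xicoef_mk (bigD1 U) //=.
rewrite setDv xicoef_mk eqxx mulr1 inversions0r mul1r.
rewrite big1 ?addr0 // => S /andP[SU nSU]; rewrite xicoef_mk setD_eq0.
suff /negPf -> : ~~ (U \subset S) by rewrite !mulr0.
by apply: contraNN nSU => US; rewrite eqEsubset SU.
Qed.

Lemma ext_mulDl : left_distributive ext_mul +%R.
Proof.
move=> f g h; apply: xicoefP => U; rewrite xicoefD !xicoef_mk -big_split /=.
by apply: eq_bigr => S _; rewrite xicoefD mulrDl mulrDr.
Qed.

Lemma ext_mulDr : right_distributive ext_mul +%R.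
Proof.
move=> f g h; apply: xicoefP => U; rewrite xicoefD !xicoef_mk -big_split /=.
by apply: eq_bigr => S _; rewrite xicoefD mulrDr mulrDr.
Qed.

Lemma ext_one_neq0 : ext_one != 0.
Proof.
apply/eqP => /(congr1 (fun f => xicoef f set0)) /eqP.
by rewrite xicoef_mk xicoef0 eqxx oner_eq0.
Qed.

HB.instance Definition _ := GRing.Zmodule_isNzRing.Build (exterior A m)
  ext_mulA ext_mul1l ext_mul1r ext_mulDl ext_mulDr ext_one_neq0.

Definition ext_scalar (c : A) : exterior A m :=
  mk_ext (fun S => if S == set0 then c else 0).

Definition xi a : exterior A m := mk_ext (fun S => (S == [set a])%:R).

(* left derivative: d_xi a (xi_a * xi_S) = xi_S for a \notin S *)
Definition d_xi a f : exterior A m :=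
  mk_ext (fun S => if a \in S then 0
    else (-1) ^+ #|[set b in S | (b < a)%N]| * xicoef f (a |: S)).

Definition ext_map (D : A -> A) f : exterior A m :=
  mk_ext (fun S => D (xicoef f S)).

Definition grade_inv f : exterior A m :=
  mk_ext (fun S => (-1) ^+ #|S| * xicoef f S).

Lemma xicoefM f g U : xicoef (f * g) U = \sum_(S : {set 'I_m} | S \subset U)
  (-1) ^+ inversions S (U :\: S) * (xicoef f S * xicoef g (U :\: S)).
Proof. exact: xicoef_mk. Qed.

Lemma xicoef_scalarM c f U : xicoef (ext_scalar c * f) U = c * xicoef f U.
Proof.
rewrite xicoefM (bigD1 set0) ?sub0set //= xicoef_mk eqxx inversions0l mul1r setD0.
by rewrite big1 ?addr0 // => S /andP[_ /negPf S0]; rewrite xicoef_mk S0 mul0r mulr0.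
Qed.

Lemma xicoef_signM k f S : xicoef ((-1) ^+ k * f) S = (-1) ^+ k * xicoef f S.
Proof.
elim: k => [|k IH]; first by rewrite !expr0 !mul1r.
by rewrite !exprS -!mulrA !mulN1r xicoefN IH.
Qed.

Lemma xicoef_xiM a f U : xicoef (xi a * f) U =
  if a \in U then (-1) ^+ #|[set b in U | (b < a)%N]| * xicoef f (U :\ a) else 0.
Proof.
rewrite xicoefM; case: ifPn => aU; last first.
  rewrite big1 // => S SU; rewrite xicoef_mk; case: eqP => [eS|_]; last first.
    by rewrite mul0r mulr0.
  by move: SU; rewrite eS sub1set (negPf aU).
rewrite (bigD1 [set a]) ?sub1set //= big1 ?addr0; last first.
  by move=> S /andP[_ /negPf Sa]; rewrite xicoef_mk Sa mul0r mulr0.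
rewrite xicoef_mk eqxx mul1r /inversions big_set1 -big_mkcondr /= sum1dep_card.
congr (_ ^+ _ * _); apply: eq_card => b; rewrite !inE.
by case: eqP => // ->; rewrite ltnn !andbF.
Qed.

Lemma cardltU1 S a b : a \notin S ->
  #|[set c in a |: S | (c < b)%N]| = ((a < b) + #|[set c in S | (c < b)%N]|)%N.
Proof.
move=> aS; rewrite -!sum1dep_card big_mkcondr big_setU1 //= -big_mkcondr /=.
by case: (a < b)%N.
Qed.

Lemma xicoef_xi2 a b U : xicoef (xi a * xi b) U =
  if (a != b) && (U == [set a; b]) then (-1) ^+ (b < a)%N else 0.
Proof.
rewrite xicoef_xiM xicoef_mk; case: ifPn => aU; last first.
  by case: ifP => // /andP[_ /eqP eU]; rewrite eU !inE eqxx in aU.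
have [<-|ab] /= := eqVneq a b.
  rewrite (_ : _ == _ = false) ?mulr0 //.
  by apply/eqP => /setP/(_ a); rewrite !inE eqxx.
have -> : (U :\ a == [set b]) = (U == [set a; b]).
  apply/eqP/eqP => [<-|->]; first by rewrite setD1K.
  by rewrite setU1K // !inE.
case: eqP => [->|_]; last by rewrite mulr0.
rewrite mulr1 cardltU1 ?inE // ltnn add0n; congr (_ ^+ _).
rewrite -sum1dep_card big_mkcondr big_set1 /=.
by case: (b < a)%N.
Qed.

Lemma xi_anticomm a b : xi a * xi b = - (xi b * xi a).
Proof.
apply: xicoefP => U; rewrite xicoefN !xicoef_xi2 eq_sym setUC.
case: ifP => [/andP[ab _]|_]; last by rewrite oppr0.
case: ltngtP ab => [_ _|_ _|/val_inj -> /eqP//]; by rewrite ?expr1 ?expr0 ?opprK.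
Qed.

Lemma xicoef_d_xi a f S : xicoef (d_xi a f) S = if a \in S then 0
  else (-1) ^+ #|[set b in S | (b < a)%N]| * xicoef f (a |: S).
Proof. exact: xicoef_mk. Qed.

Lemma d_xi_xiM a b f :
  d_xi a (xi b * f) = (if a == b then f else 0) - xi b * d_xi a f.
Proof.
apply: xicoefP => S; rewrite xicoefD xicoefN xicoef_d_xi !xicoef_xiM xicoef_d_xi !inE.
have [<-|ab] := eqVneq a b.
  rewrite /=; case: ifPn => aS; last first.
    by rewrite oppr0 addr0 setU1K // cardltU1 // ltnn mulrA -expr2 sqrr_sign mul1r.
  have -> : #|[set b in S | (b < a)%N]| = #|[set b in S :\ a | (b < a)%N]|.
    by rewrite -{1}(setD1K aS) cardltU1 ?ltnn ?inE ?eqxx.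
  by rewrite /= setD1K // mulrA -expr2 sqrr_sign mul1r subrr.
rewrite xicoef0 add0r /=.
case: ifPn => aS /=; first by case: ifP; rewrite ?mulr0 oppr0.
case: ifPn => bS; last by rewrite mulr0 oppr0.
have bSb : b \notin S :\ b by rewrite !inE eqxx.
have -> : (a |: S) :\ b = a |: (S :\ b).
  by rewrite setDUl; congr (_ :|: _); apply/setDidPl; rewrite disjoints1 inE.
rewrite cardltU1 //.
have -> : #|[set c in S | (c < a)%N]|
    = ((b < a) + #|[set c in S :\ b | (c < a)%N]|)%N.
  by rewrite -{1}(setD1K bS) cardltU1.
rewrite !exprD.
case: ltngtP ab => [_ _|_ _|/val_inj -> /eqP//]; rewrite expr0 expr1; ring.
Qed.

Lemma grade_invE k f : (forall S, xicoef f S != 0 -> odd #|S| = odd k) ->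
  grade_inv f = (-1) ^+ k * f.
Proof.
move=> fk; apply: xicoefP => S; rewrite xicoef_signM xicoef_mk.
have [->|/fk e] := eqVneq (xicoef f S) 0; first by rewrite !mulr0.
by rewrite -signr_odd e signr_odd.
Qed.

Lemma d_xi_signM k a f : d_xi a ((-1) ^+ k * f) = (-1) ^+ k * d_xi a f.
Proof.
apply: xicoefP => S; rewrite xicoef_signM !xicoef_d_xi xicoef_signM.
by case: ifP => _; rewrite ?mulr0 // mulrCA.
Qed.
End Exterior.

From mathcomp Require Import all_classical all_reals all_analysis.
(* mpoly is imported without its notations, which clash with those of
   MathComp-Analysis: [mpoly n A] is the ring of polynomials in n commuting
   variables over A, and [multinom n] the type of their exponents. *)
From mathcomp Require Import -(notations) mpoly.

Import numFieldNormedType.Exports.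

(* Coordinate functions x^mu, p_mu (mu < n) and xi^a (a < m); elements of
   [gfun R n m] are polynomials in p and xi whose coefficients are functions
   of x.  The coefficients are functions on the whole of R^n of which only the
   restriction to the coordinate domain U matters: smoothness is required, and
   equations between elements of [gfun R n m] are stated, on U only. *)
Notation gfun R n m := (exterior (mpoly n ('rV[R]_n -> R)) m).

Section GradedFunctions.
Variables (R : realType) (n m : nat).
Implicit Types (f g : gfun R n m) (u : 'rV[R]_n -> R) (U : set 'rV[R]_n).
Implicit Types (mu : 'I_n) (a : 'I_m) (K : 'M[R]_m).

Definition pd mu u : 'rV[R]_n -> R := fun x => 'D_(delta_mx 0 mu) u x.

Definition smooth_on U u : Prop := forall (s : seq 'I_n) (x : 'rV[R]_n), U x ->
  let v := foldr pd u s in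
  {for x, continuous v} /\ forall mu, derivable v x (delta_mx 0 mu).

Definition fx u : gfun R n m := ext_scalar m (mpolyC n u).

Definition pvar mu : gfun R n m := ext_scalar m (mpolyX _ (mnm1 mu)).

Definition xivar a : gfun R n m := xi _ a.

Definition dx mu f : gfun R n m := ext_map (map_mpoly (pd mu)) f.

Definition dp mu f : gfun R n m := ext_map (mderiv mu) f.

Definition dxi a f : gfun R n m := d_xi a f.

Definition eq0_on U f : Prop :=
  forall (S : {set 'I_m}) (k : multinom n) (x : 'rV[R]_n), U x ->
    mcoeff k (xicoef f S) x = 0.

Definition homogeneous (k : nat) f : Prop :=
  forall (S : {set 'I_m}) (j : multinom n),
    mcoeff j (xicoef f S) != 0 -> (#|S| + 2 * mdeg j)%N = k.

(* Bilinear extension to inhomogeneous f of the bracket with sign (-1)^k for f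
   homogeneous of degree k; as x and p are even, (-1)^k f is [grade_inv f]
   (see pbracket_homogeneous). *)
Definition pbracket K f g : gfun R n m :=
  \sum_(mu < n) (dx mu f * dp mu g - dp mu f * dx mu g)
  + \sum_(a < m) \sum_(b < m)
      dxi a (grade_inv f) * fx (cst (invmx K a b)) * dxi b g.

Lemma pbracket_homogeneous K k f g : homogeneous k f ->
  pbracket K f g =
  \sum_(mu < n) (dx mu f * dp mu g - dp mu f * dx mu g)
  + (-1) ^+ k * \sum_(a < m) \sum_(b < m)
      dxi a f * fx (cst (invmx K a b)) * dxi b g.
Proof.
move=> fk; rewrite /pbracket; congr (_ + _); rewrite mulr_sumr.
apply: eq_bigr => a _; rewrite mulr_sumr; apply: eq_bigr => b _.
have -> : dxi a (grade_inv f) = (-1) ^+ k * dxi a f.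
  rewrite /dxi (@grade_invE _ _ k) ?d_xi_signM // => S fS0.
  case: (pselect (exists j, mcoeff j (xicoef f S) != 0)) => [[j /fk <-]|nf].
    by rewrite oddD oddM addbF.
  case/eqP: fS0; apply/mpolyP => j; rewrite mcoeff0; apply/eqP.
  by apply: contra_notT nf => fj; exists j.
by rewrite !mulrA.
Qed.

Definition skew3_on U (T : 'I_m -> 'I_m -> 'I_m -> 'rV[R]_n -> R) : Prop :=
  forall a b c x, U x -> T b a c x = - T a b c x /\ T a c b x = - T a b c x.

Definition alt3 (F : 'I_m -> 'I_m -> 'I_m -> 'rV[R]_n -> R) a b c :
    'rV[R]_n -> R :=
  (6%:R : R)^-1 *: (F a b c + F b c a + F c a b - F b a c - F a c b - F c b a).

(* rho a mu = rho_a^mu and T a b c = T_abc *)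
Definition hamiltonian (rho : 'I_m -> 'I_n -> 'rV[R]_n -> R)
    (T : 'I_m -> 'I_m -> 'I_m -> 'rV[R]_n -> R) : gfun R n m :=
  \sum_(a < m) \sum_(mu < n) fx (rho a mu) * xivar a * pvar mu
  + \sum_(a < m) \sum_(b < m) \sum_(c < m)
      fx ((6%:R : R)^-1 *: T a b c) * xivar a * xivar b * xivar c.

Section Deformation.
Variables (K : 'M[R]_m) (rho : 'I_m -> 'I_n -> 'rV[R]_n -> R).
Variable (T : 'I_m -> 'I_m -> 'I_m -> 'rV[R]_n -> R).

(* rho^{b|mu} *)
Definition rho_up b mu : 'rV[R]_n -> R :=
  \sum_(c < m) invmx K b c *: rho c mu.

(* T_{ab}^c *)
Definition T_up3 a b c : 'rV[R]_n -> R :=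
  \sum_(d < m) invmx K c d *: T a b d.

(* T_a^{bc} *)
Definition T_up23 a b c : 'rV[R]_n -> R :=
  \sum_(d < m) \sum_(e < m) (invmx K b d * invmx K c e) *: T a d e.

Definition rho_dot a mu : 'rV[R]_n -> R :=
  \sum_(b < m) \sum_(la < n) \sum_(nu < n)
    rho b la * pd la (rho a nu) * pd nu (rho_up b mu)
  + \sum_(b < m) \sum_(c < m) \sum_(la < n)
    rho b la * pd la (rho c mu) * T_up23 a b c.

Definition T_dot a b c : 'rV[R]_n -> R :=
  \sum_(mu < n) \sum_(nu < n) \sum_(la < n)
    pd mu (rho a nu) * pd nu (rho b la) * pd la (rho c mu)
  - \sum_(mu < n) \sum_(nu < n) \sum_(la < n)
    pd mu (rho a la) * pd nu (rho b mu) * pd la (rho c nu)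
  - \sum_(d < m) \sum_(e < m) \sum_(f < m)
    T_up23 a d e * T b d f * T_up3 c e f
  + 3%:R * alt3 (fun a b c => \sum_(d < m) \sum_(mu < n) \sum_(nu < n)
      rho d mu * pd mu (rho a nu) * pd nu (T_up3 b c d)) a b c
  + 3%:R * alt3 (fun a b c => \sum_(d < m) \sum_(e < m) \sum_(mu < n)
      rho d mu * T_up23 a d e * pd mu (T b c e)) a b c.

End Deformation.
End GradedFunctions.

(* Main.v *)
(* Write Q = {H, -} and let X be the Hamiltonian vector field of H, so that
   Q = sum_j X^j d_j.  The master equation gives Q X^j = 0; differentiating,
   the Jacobian M_ij = d_i X^j satisfies Q M = - J M^2, with J the parity
   signature, hence Q (tr M^3) = - str M^4, which vanishes because M^4 is half
   the supercommutator of M and M^3.  Since the p_mu p_nu-part of the master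
   equation makes the image of rho isotropic for the inverse of kappa, tr M^3
   is - 6 times the deformation of H.  All equations hold on U only; they
   become exact over the ring of functions smooth on U, after multiplying the
   data and the derivations by the indicator function of U. *)
From HB Require Import structures.
From mathcomp Require Import all_boot all_order all_algebra.
From mathcomp Require Import ring.
Require Import Defs.
Set Implicit Arguments.
Unset Strict Implicit.
Import GRing.Theory.
Local Open Scope ring_scope.

(** With [deg] equal to 0, 1, 2 on x, xi, p, the entry [M i j] has degree 1 + deg j - deg i, so a
    closed cycle of three entries has degree 3, the degree of H: this is why the cube is taken.
    Modulo 2 the matrix M is odd. The unsigned trace of its cube is cyclic because M_ij M_jk and
    M_ki have opposite parities and hence commute; for the even matrix M^4 the cyclic trace is the
    supertrace. The Leibniz rule on the three factors gives M^4 with signs -, +, -, which leaves one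
    copy.

    Isotropy enters because second x-derivatives of H, which do not occur in the deformation,
    survive only in the cycle x, p, y, and there they multiply the contraction of rho with its
    raised version.

    The coefficients in the statement are arbitrary functions on R^n, on which partial derivatives
    are neither additive nor commuting. The algebra is therefore done over an abstract ring with
    commuting derivations, and the result is carried back along a relation of agreement on U. *)

Section SuperTrace.

(** * Odd vector fields and the trace of the cube of their Jacobian *)

Variables (B : nzRingType) (I : finType) (par : I -> bool).
Variables (sigma : B -> B) (d : I -> B -> B) (X : I -> B).

Definition has_parity b f := sigma f = (-1) ^+ (b : bool) * f.

Lemma has_parity_odd f : has_parity true f <-> sigma f = - f.
Proof. by rewrite /has_parity mulN1r. Qed.

Lemma has_parity_even f : has_parity false f <-> sigma f = f.
Proof. by rewrite /has_parity mul1r. Qed.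

Hypothesis sigmaM : forall f g, sigma (f * g) = sigma f * sigma g.
Hypothesis supercomm : forall b c f g, has_parity b f -> has_parity c g ->
  f * g = (-1) ^+ (b && c) * (g * f).
Hypothesis dD : forall i f g, d i (f + g) = d i f + d i g.
Hypothesis dM : forall i b f g, has_parity b f ->
  d i (f * g) = d i f * g + (-1) ^+ (par i && b) * (f * d i g).
Hypothesis dd : forall i j f, d i (d j f) = (-1) ^+ (par i && par j) * d j (d i f).
Hypothesis d_parity : forall i b f, has_parity b f -> has_parity (b (+) par i) (d i f).
Hypothesis X_parity : forall i, has_parity (~~ par i) (X i).

Definition vfield f : B := \sum_j X j * d j f.

Definition jacobian i j : B := d i (X j).

Definition cube_trace : B :=
  \sum_i \sum_j \sum_k jacobian i j * jacobian j k * jacobian k i.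

Local Notation M := jacobian.

Lemma signM_comm (b : bool) (f g : B) : f * ((-1) ^+ b * g) = (-1) ^+ b * (f * g).
Proof. by rewrite mulrA commr_sign mulrA. Qed.

Lemma signMM (b c : bool) (f : B) :
  (-1) ^+ b * ((-1) ^+ c * f) = (-1) ^+ (b (+) c) * f.
Proof. by rewrite mulrA -signr_addb. Qed.

Lemma has_parityM b c f g : has_parity b f -> has_parity c g ->
  has_parity (b (+) c) (f * g).
Proof.
by move=> hf hg; rewrite /has_parity sigmaM hf hg -mulrA signM_comm mulrA signr_addb.
Qed.

Let d0 i : d i 0 = 0.
Proof. by apply: (addrI (d i 0)); rewrite -dD !addr0. Qed.

Let d_sum i (J : finType) (F : J -> B) : d i (\sum_j F j) = \sum_j d i (F j).
Proof. by apply: (big_morph (d i) (dD i) (d0 i)). Qed.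

Lemma vfieldD f g : vfield (f + g) = vfield f + vfield g.
Proof. by rewrite /vfield -big_split; apply: eq_bigr => j _; rewrite dD mulrDr. Qed.

Lemma vfield_sum (J : finType) (F : J -> B) :
  vfield (\sum_j F j) = \sum_j vfield (F j).
Proof.
by apply: (big_morph vfield vfieldD); rewrite /vfield big1 // => j _; rewrite d0 mulr0.
Qed.

(** [X j] has the parity opposite to that of [d j], so every term [X j * d j] is odd; moving it past
    f costs the sign of f, whatever j is. *)
Lemma vfieldM b f g : has_parity b f ->
  vfield (f * g) = vfield f * g + (-1) ^+ b * (f * vfield g).
Proof.
move=> hf; rewrite /vfield mulr_suml mulr_sumr mulr_sumr -big_split.
apply: eq_bigr => j _; rewrite (dM _ _ hf) mulrDr mulrA; congr (_ + _).
rewrite signM_comm (mulrA (X j)) (supercomm (X_parity j) hf) -!mulrA signMM.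
congr (_ ^+ _ * _).
by case: (par j); case: b {hf}.
Qed.

Lemma jacobian_parity i j : has_parity (~~ (par i (+) par j)) (M i j).
Proof.
have := d_parity i (X_parity j).
by congr has_parity; case: (par i); case: (par j).
Qed.

Hypothesis vfield_X : forall j, vfield (X j) = 0.

(** Differentiate Q X^j = 0. The sign of moving [d i] past [X k] and that of exchanging [d i] and
    [d k] combine to (-1)^(par i), which does not depend on k, so the second-order terms sum to a
    multiple of Q M_ij. *)
Lemma vfield_jacobian i j :
  vfield (M i j) = - ((-1) ^+ par i * \sum_k M i k * M k j).
Proof.
have : d i (vfield (X j)) = 0 by rewrite vfield_X d0.
rewrite /vfield d_sum (eq_bigr (fun k => M i k * M k j
   + (-1) ^+ par i * (X k * d k (M i j)))); last first.
  move=> k _; rewrite (dM _ _ (X_parity k)) dd signM_comm signMM.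
  by congr (_ + _ ^+ _ * _); case: (par i); case: (par k).
rewrite big_split /= -mulr_sumr => /eqP; rewrite addrC addr_eq0 => /eqP e.
by rewrite -mulrN -e signMM addbb mul1r.
Qed.

Let M2 i j := \sum_k M i k * M k j.

Let M3 i j := \sum_k M i k * M2 k j.

Let M3E i j : M3 i j = \sum_k M2 i k * M k j.
Proof.
rewrite /M3 /M2; under eq_bigr do rewrite mulr_sumr.
rewrite exchange_big; apply: eq_bigr => k _; rewrite mulr_suml.
by apply: eq_bigr => l _; rewrite mulrA.
Qed.

Hypothesis sigmaD : forall f g, sigma (f + g) = sigma f + sigma g.
Hypothesis torsion2 : forall f : B, f + f = 0 -> f = 0.

Let sigma_sum (J : finType) b (F : J -> B) :
  (forall j, has_parity b (F j)) -> has_parity b (\sum_j F j).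
Proof.
move=> hF; have s0 : sigma 0 = 0 by apply: (addrI (sigma 0)); rewrite -sigmaD !addr0.
rewrite /has_parity (big_morph sigma sigmaD s0) mulr_sumr.
by apply: eq_bigr => j _; exact: hF.
Qed.

Let M2_parity i j : has_parity (par i (+) par j) (M2 i j).
Proof.
apply: sigma_sum => k.
have := has_parityM (jacobian_parity i k) (jacobian_parity k j).
by congr has_parity; case: (par i); case: (par j); case: (par k).
Qed.

Let M3_parity i j : has_parity (~~ (par i (+) par j)) (M3 i j).
Proof.
apply: sigma_sum => k.
have := has_parityM (jacobian_parity i k) (M2_parity k j).
by congr has_parity; case: (par i); case: (par j); case: (par k).
Qed.

(* The supertrace of the supercommutator [M, M ^ 3], which is twice M ^ 4. *)
Lemma supertrace_M4 : \sum_i (-1) ^+ par i * \sum_j M i j * M3 j i = 0.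
Proof.
apply: torsion2; rewrite -[X in X + _]opprK; apply/eqP; rewrite addrC subr_eq0; apply/eqP.
rewrite -sumrN.
under [LHS]eq_bigr do rewrite mulr_sumr.
have MM3 j : \sum_i M j i * M3 i j = \sum_i M3 j i * M i j.
  rewrite {1}/M3; under eq_bigr do rewrite mulr_sumr.
  rewrite exchange_big /=; under [RHS]eq_bigr do rewrite M3E mulr_suml.
  rewrite [RHS]exchange_big /=.
  under eq_bigr do under eq_bigr do rewrite mulrA.
  under [RHS]eq_bigr do under eq_bigr do rewrite -mulrA.
  by apply: eq_bigr => k _; rewrite -mulr_suml -mulr_sumr.
under [RHS]eq_bigr do rewrite MM3 mulr_sumr -sumrN.
(* Both factors have parity 1 + par i + par j. Exchanging them turns the weight (-1)^(par i) into -
   (-1)^(par j), so the supertrace equals its own opposite. *)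
rewrite exchange_big /=; apply: eq_bigr => j _; apply: eq_bigr => i _.
rewrite (supercomm (jacobian_parity i j) (M3_parity j i)) signMM.
rewrite -mulNr; congr (_ * _).
by case: (par i); case: (par j); rewrite ?expr0 ?expr1 ?opprK.
Qed.

Lemma vfield_cube_trace : vfield cube_trace = 0.
Proof.
suff -> : vfield cube_trace = - \sum_i (-1) ^+ par i * \sum_j M i j * M3 j i.
  by rewrite supertrace_M4 oppr0.
rewrite /cube_trace !vfield_sum.
pose S i j k := (-1) ^+ par i * (M i j * M2 j k * M k i).
(* Q passes factors of parity 1 + par i + par j and par i + par k, and Q M has weights par i, par j,
   par k in turn. In all three terms the total weight becomes (-1)^(par i), with alternating signs.
   Each term sums to the same diagonal entry of M^4, so one copy with sign - remains. *)
have e i j k : vfield (M i j * M j k * M k i) =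
  - ((-1) ^+ par i * (M2 i j * (M j k * M k i))) + S i j k
  - (-1) ^+ par i * (M i j * M j k * M2 k i).
  have hij := jacobian_parity i j.
  have hijk := has_parityM hij (jacobian_parity j k).
  rewrite (vfieldM _ hijk) (vfieldM _ hij) !vfield_jacobian mulrDl.
  congr (_ + _ + _).
  - by rewrite !mulNr -!mulrA.
  - rewrite mulrN signM_comm mulrN mulrA -signr_addb -mulNr -mulrA /S.
    by rewrite -mulrA; case: (par i); case: (par j); rewrite ?expr0 ?expr1 ?opprK.
  - rewrite mulrN signM_comm mulrN mulrA -signr_addb.
    by case: (par i); case: (par j); case: (par k); rewrite ?expr0 ?expr1 ?opprK.
under eq_bigr do rewrite vfield_sum; under eq_bigr do under eq_bigr do rewrite vfield_sum.
under eq_bigr do under eq_bigr do under eq_bigr do rewrite e.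
rewrite -sumrN; apply: eq_bigr => i _.
set W := \sum_j M i j * M3 j i.
under eq_bigr do rewrite !big_split.
rewrite !big_split /=.
have -> : \sum_j \sum_k - ((-1) ^+ par i * (M2 i j * (M j k * M k i)))
   = - ((-1) ^+ par i * W).
  have <- : \sum_j M2 i j * M2 j i = W.
    under eq_bigr => j _ do rewrite [M2 i j]/M2 mulr_suml.
    rewrite exchange_big; apply: eq_bigr => l _; rewrite /M3 mulr_sumr.
    by apply: eq_bigr => j _; rewrite mulrA.
  rewrite mulr_sumr -sumrN; apply: eq_bigr => j _; rewrite {2}/M2 !mulr_sumr -sumrN.
  by apply: eq_bigr.
have -> : \sum_j \sum_k S i j k = (-1) ^+ par i * W.
  rewrite /W mulr_sumr; apply: eq_bigr => j _; rewrite M3E !mulr_sumr.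
  by apply: eq_bigr => k _; rewrite /S mulrA.
have -> : \sum_j \sum_k - ((-1) ^+ par i * (M i j * M j k * M2 k i))
   = - ((-1) ^+ par i * W).
  rewrite /W mulr_sumr -sumrN; apply: eq_bigr => j _.
  rewrite /M3 !mulr_sumr -sumrN; apply: eq_bigr => k _.
  by rewrite !mulrA.
by rewrite addNr add0r.
Qed.
End SuperTrace.

(** * The exterior algebra: supercommutativity and graded derivations *)

Section ExteriorTheory.
Variables (A : comNzRingType) (m : nat).
Implicit Types (f g : exterior A m) (c : A) (a b : 'I_m) (S U : {set 'I_m}).

Lemma xicoef_scalar c S : xicoef (ext_scalar m c) S = if S == set0 then c else 0.
Proof. exact: xicoef_mk. Qed.

Lemma xicoefM_scalar c f U : xicoef (f * ext_scalar m c) U = xicoef f U * c.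
Proof.
rewrite xicoefM (bigD1 U) //= setDv xicoef_scalar eqxx inversions0r mul1r.
rewrite big1 ?addr0 // => S /andP[SU nSU]; rewrite xicoef_scalar setD_eq0.
suff /negPf -> : ~~ (U \subset S) by rewrite !mulr0.
by apply: contraNN nSU => US; rewrite eqEsubset SU.
Qed.

Lemma xicoef_set0M f g : xicoef (f * g) set0 = xicoef f set0 * xicoef g set0.
Proof.
rewrite xicoefM (bigD1 set0) //= inversions0l mul1r setD0 big1 ?addr0 // => S.
by rewrite subset0 => /andP[/eqP ->]; rewrite eqxx.
Qed.

Lemma xicoef_set0_xi a : xicoef (xi A a) set0 = 0.
Proof.
rewrite xicoef_mk (_ : _ == _ = false) //.
by apply/eqP => /setP/(_ a); rewrite !inE eqxx.
Qed.

Lemma ext_scalarC c f : f * ext_scalar m c = ext_scalar m c * f.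
Proof. by apply: xicoefP => U; rewrite xicoefM_scalar xicoef_scalarM mulrC. Qed.

Lemma ext_scalar_is_zmod_morphism : zmod_morphism (@ext_scalar A m).
Proof.
move=> c d; apply: xicoefP => S; rewrite xicoefD xicoefN !xicoef_scalar.
by case: ifP; rewrite ?subr0.
Qed.

Lemma ext_scalar_is_monoid_morphism : monoid_morphism (@ext_scalar A m).
Proof.
split=> [|c d]; apply: xicoefP => S.
  by rewrite xicoef_scalar xicoef_mk; case: ifP.
by rewrite xicoef_scalarM !xicoef_scalar; case: ifP; rewrite ?mulr0.
Qed.

HB.instance Definition _ := GRing.isZmodMorphism.Build A (exterior A m)
  (@ext_scalar A m) ext_scalar_is_zmod_morphism.
HB.instance Definition _ := GRing.isMonoidMorphism.Build A (exterior A m)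
  (@ext_scalar A m) ext_scalar_is_monoid_morphism.

(** Every element is a sum of monomials c * xi_S, and each monomial is built by left multiplication
    with one generator at a time. Additive identities can thus be proved without handling the signs
    of [inversions]. *)
Lemma exterior_ind (Q : exterior A m -> Prop) :
  (forall f g, Q f -> Q g -> Q (f + g)) -> (forall c, Q (ext_scalar m c)) ->
  (forall a f, Q f -> Q (xi A a * f)) -> forall f, Q f.
Proof.
move=> QD Qc Qx f.
pose mono S c : exterior A m := mk_ext (fun U => if U == S then c else 0).
have Qmono k : forall S c, #|S| = k -> Q (mono S c).
  elim: k => [|k IH] S c.
    by move=> /eqP; rewrite cards_eq0 => /eqP ->; exact: Qc.
  move=> Sk; have /card_gt0P[a aS] : (0 < #|S|)%N by rewrite Sk.
  (* The sign of moving xi_a from the front to its place in xi_S; it is its own inverse. *)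
  pose s : A := (-1) ^+ #|[set b in S | (b < a)%N]|.
  have -> : mono S c = xi A a * mono (S :\ a) (s * c).
    apply: xicoefP => U; rewrite xicoef_xiM !xicoef_mk.
    have [->|nUS] := eqVneq U S; first by rewrite aS eqxx mulrA -expr2 sqrr_sign mul1r.
    case: ifP => // aU; case: eqP => [e|]; last by rewrite mulr0.
    by rewrite -(setD1K aU) e setD1K ?eqxx in nUS.
  by apply/Qx/IH; move: Sk; rewrite (cardsD1 a) aS => -[].
have -> : f = \sum_S mono S (xicoef f S).
  apply: xicoefP => U; rewrite xicoef_sum (bigD1 U) //= xicoef_mk eqxx.
  by rewrite big1 ?addr0 // => S /negPf nSU; rewrite xicoef_mk eq_sym nSU.
have Q0 : Q 0 by rewrite -(raddf0 (@ext_scalar A m)); exact: Qc.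
by apply: big_ind => // S _; exact: Qmono.
Qed.

Lemma grade_invD f g : grade_inv (f + g) = grade_inv f + grade_inv g.
Proof. by apply: xicoefP => S; rewrite !(xicoefD, xicoef_mk) mulrDr. Qed.

Lemma grade_inv0 : grade_inv 0 = 0 :> exterior A m.
Proof. by apply: (addrI (grade_inv 0 : exterior A m)); rewrite -grade_invD !addr0. Qed.

Lemma grade_invM f g : grade_inv (f * g) = grade_inv f * grade_inv g.
Proof.
apply: xicoefP => U; rewrite xicoef_mk !xicoefM mulr_sumr.
apply: eq_bigr => S SU; rewrite !xicoef_mk mulrCA; congr (_ * _).
rewrite mulrACA -exprD; congr (_ ^+ _ * _).
by rewrite -(cardsID S U) (setIidPr SU).
Qed.

Lemma grade_inv_scalar c : grade_inv (ext_scalar m c) = ext_scalar m c.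
Proof.
apply: xicoefP => S; rewrite xicoef_mk xicoef_scalar.
by case: ifP => [/eqP ->|_]; rewrite ?mulr0 // cards0 mul1r.
Qed.

Lemma grade_inv_xi a : grade_inv (xi A a) = - xi A a.
Proof.
apply: xicoefP => S; rewrite xicoefN !xicoef_mk.
by case: eqP => [->|_]; rewrite ?mulr0 ?oppr0 // cards1 mulN1r.
Qed.

Lemma mulr_xi a f : f * xi A a = xi A a * grade_inv f.
Proof.
elim/exterior_ind: f => [f g ef eg|c|b f ef].
- by rewrite mulrDl ef eg grade_invD mulrDr.
- by rewrite grade_inv_scalar ext_scalarC.
- by rewrite -mulrA ef mulrA xi_anticomm grade_invM grade_inv_xi !mulNr mulrN mulrA.
Qed.

Lemma exterior_supercomm (b c : bool) f g :
  has_parity (@grade_inv A m) b f -> has_parity (@grade_inv A m) c g ->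
  f * g = (-1) ^+ (b && c) * (g * f).
Proof.
rewrite /has_parity => hf hg.
(* In this form g need not be homogeneous, which makes induction on g possible. *)
suff -> : f * g = (if b then grade_inv g else g) * f.
  by case: b {hf} => /=; rewrite ?mul1r // hg mulrA.
elim/exterior_ind: g {hg} => [g h eg eh|d|a g eg].
- by rewrite mulrDr eg eh -mulrDl grade_invD; case: b {hf eg eh}.
- by rewrite grade_inv_scalar if_same ext_scalarC.
- rewrite mulrA mulr_xi hf -mulrA -mulrA eg grade_invM grade_inv_xi.
  by case: b {hf eg}; rewrite ?expr1 ?mul1r ?mulN1r ?mulrN ?mulNr !mulrA.
Qed.

Lemma d_xiD a f g : d_xi a (f + g) = d_xi a f + d_xi a g.
Proof.
apply: xicoefP => S; rewrite xicoefD !xicoef_d_xi xicoefD.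
by case: ifP; rewrite ?addr0 // mulrDr.
Qed.

Lemma d_xi_scalarM a c f : d_xi a (ext_scalar m c * f) = ext_scalar m c * d_xi a f.
Proof.
apply: xicoefP => S; rewrite xicoef_scalarM !xicoef_d_xi xicoef_scalarM.
by case: ifP; rewrite ?mulr0 // mulrCA.
Qed.

Lemma d_xi_scalar a c : d_xi a (ext_scalar m c) = 0.
Proof.
apply: xicoefP => S; rewrite xicoef_d_xi xicoef_scalar xicoef0.
case: ifP => // _; case: eqP => [/setP/(_ a)|_]; last by rewrite mulr0.
by rewrite !inE eqxx.
Qed.

(** [grade_inv f] carries the Leibniz sign for each homogeneous component of f separately. *)
Lemma d_xiM a f g : d_xi a (f * g) = d_xi a f * g + grade_inv f * d_xi a g.
Proof.
elim/exterior_ind: f => [f h ef eh|c|b f ef].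
- by rewrite mulrDl !d_xiD ef eh grade_invD !mulrDl addrACA.
- by rewrite d_xi_scalarM d_xi_scalar grade_inv_scalar mul0r add0r.
- rewrite -mulrA !d_xi_xiM ef grade_invM grade_inv_xi mulrDr opprD addrA mulrBl.
  by rewrite !mulNr -!mulrA; case: eqP; rewrite ?mul0r.
Qed.

Lemma d_xi_anticomm a b f : d_xi a (d_xi b f) = - d_xi b (d_xi a f).
Proof.
have dN e g : d_xi e (- g) = - d_xi e g by have := d_xi_signM 1 e g; rewrite !mulN1r.
have d0 e : d_xi e 0 = 0 :> exterior A m by move: (d_xi_scalar e 0); rewrite raddf0.
elim/exterior_ind: f => [f g ef eg|c|e f ef].
- by rewrite !d_xiD ef eg opprD.
- by rewrite !d_xi_scalar !d0 oppr0.
- rewrite !d_xi_xiM !d_xiD !dN !d_xi_xiM ef mulrN !(fun_if (d_xi _)) !d0 opprK.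
  by rewrite opprD [RHS]opprD opprK addrCA.
Qed.

Lemma grade_inv_d_xi a f : grade_inv (d_xi a f) = - d_xi a (grade_inv f).
Proof.
apply: xicoefP => S; rewrite xicoefN xicoef_mk !xicoef_d_xi xicoef_mk.
case: ifPn => aS; first by rewrite mulr0 oppr0.
by rewrite cardsU1 aS exprD expr1; ring.
Qed.

Section Derivation.
Variable D : A -> A.
Hypothesis DD : forall c d, D (c + d) = D c + D d.
Hypothesis DM : forall c d, D (c * d) = D c * d + c * D d.

Let D0 : D 0 = 0.
Proof. by apply: (addrI (D 0)); rewrite -DD !addr0. Qed.

Let D1 : D 1 = 0.
Proof. by apply: (addrI (D 1)); have := DM 1 1; rewrite !mulr1 mul1r addr0 => <-. Qed.

Let Dsign k c : D ((-1) ^+ k * c) = (-1) ^+ k * D c.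
Proof.
have DN d : D (- d) = - D d by apply/eqP; rewrite -addr_eq0 -DD addNr D0.
by rewrite -signr_odd; case: (odd k); rewrite ?mulN1r ?mul1r.
Qed.

Lemma ext_mapD f g : ext_map D (f + g) = ext_map D f + ext_map D g.
Proof. by apply: xicoefP => S; rewrite !(xicoef_mk, xicoefD) DD. Qed.

Lemma ext_mapM f g : ext_map D (f * g) = ext_map D f * g + f * ext_map D g.
Proof.
apply: xicoefP => U; rewrite xicoef_mk xicoefD !xicoefM (big_morph D DD D0) -big_split.
by apply: eq_bigr => S _ /=; rewrite Dsign DM mulrDr !xicoef_mk.
Qed.

Lemma ext_map_scalar c : ext_map D (ext_scalar m c) = ext_scalar m (D c).
Proof. by apply: xicoefP => S; rewrite xicoef_mk !xicoef_scalar; case: ifP. Qed.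

Lemma ext_map_xi a : ext_map D (xi A a) = 0.
Proof. by apply: xicoefP => S; rewrite xicoef0 !xicoef_mk; case: eqP. Qed.

Lemma ext_map_d_xi a f : ext_map D (d_xi a f) = d_xi a (ext_map D f).
Proof. by apply: xicoefP => S; rewrite !xicoef_mk; case: ifP; rewrite // Dsign. Qed.

Lemma ext_map_grade_inv f : ext_map D (grade_inv f) = grade_inv (ext_map D f).
Proof. by apply: xicoefP => S; rewrite !xicoef_mk Dsign. Qed.
End Derivation.

Lemma ext_mapC (D E : A -> A) f : (forall c, D (E c) = E (D c)) ->
  ext_map D (ext_map E f) = ext_map E (ext_map D f).
Proof. by move=> DE; apply: xicoefP => S; rewrite !xicoef_mk. Qed.
End ExteriorTheory.

(** * Forms of degree one, two and three in xi *)

Section XiPolynomials.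
Variables (P : comNzRingType) (m : nat).

Local Notation B := (exterior P m).
Local Notation S := (ext_scalar m).
Local Notation xi := (xi P).

Definition xi_poly1 (f : 'I_m -> P) : B := \sum_a S (f a) * xi a.

(** The coefficient families of quadratic and cubic forms are arbitrary: only their skewsymmetric
    part matters. Instead of skewsymmetrising, one permutes the indices of a family at the cost of
    the sign of the permutation. *)
Definition xi_poly2 (f : 'I_m -> 'I_m -> P) : B :=
  \sum_a \sum_b S (f a b) * (xi a * xi b).

Definition xi_poly3 (f : 'I_m -> 'I_m -> 'I_m -> P) : B :=
  \sum_a \sum_b \sum_c S (f a b c) * (xi a * (xi b * xi c)).

Lemma eq_xi_poly1 f g : f =1 g -> xi_poly1 f = xi_poly1 g.
Proof. by move=> e; apply: eq_bigr => a _; rewrite e. Qed.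

Lemma eq_xi_poly2 f g : f =2 g -> xi_poly2 f = xi_poly2 g.
Proof. by move=> e; apply: eq_bigr => a _; apply: eq_bigr => b _; rewrite e. Qed.

Lemma eq_xi_poly3 f g : (forall a b c, f a b c = g a b c) -> xi_poly3 f = xi_poly3 g.
Proof.
by move=> e; apply: eq_bigr => a _; apply: eq_bigr => b _; apply: eq_bigr => c _; rewrite e.
Qed.

Section ExtMap.
Variable D : P -> P.
Hypothesis DD : forall c d, D (c + d) = D c + D d.
Hypothesis DM : forall c d, D (c * d) = D c * d + c * D d.

Lemma deriv_sum (J : finType) (F : J -> P) : D (\sum_j F j) = \sum_j D (F j).
Proof.
by apply: (big_morph D DD); apply: (addrI (D 0)); rewrite -DD !addr0.
Qed.

Lemma ext_map_sum (J : finType) (F : J -> B) :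
  ext_map D (\sum_j F j) = \sum_j ext_map D (F j).
Proof.
apply: (big_morph (@ext_map P m D) (ext_mapD DD)).
by apply: (addrI (ext_map D (0 : B))); rewrite -ext_mapD // !addr0.
Qed.

Lemma ext_map_xiM a (f : B) : ext_map D (xi a * f) = xi a * ext_map D f.
Proof. by rewrite ext_mapM // ext_map_xi // mul0r add0r. Qed.

Lemma ext_map_scalarM c (f : B) : ext_map D f = 0 -> ext_map D (S c * f) = S (D c) * f.
Proof. by move=> e; rewrite ext_mapM // ext_map_scalar // e mulr0 addr0. Qed.

Lemma ext_map_poly1 f : ext_map D (xi_poly1 f) = xi_poly1 (fun a => D (f a)).
Proof.
rewrite ext_map_sum; apply: eq_bigr => a _.
by rewrite ext_map_scalarM // ext_map_xi.
Qed.

Lemma ext_map_poly2 f : ext_map D (xi_poly2 f) = xi_poly2 (fun a b => D (f a b)).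
Proof.
rewrite ext_map_sum; apply: eq_bigr => a _; rewrite ext_map_sum; apply: eq_bigr => b _.
by rewrite ext_map_scalarM // ext_map_xiM ext_map_xi // mulr0.
Qed.

Lemma ext_map_poly3 f :
  ext_map D (xi_poly3 f) = xi_poly3 (fun a b c => D (f a b c)).
Proof.
rewrite ext_map_sum; apply: eq_bigr => a _; rewrite ext_map_sum; apply: eq_bigr => b _.
rewrite ext_map_sum; apply: eq_bigr => c _.
by rewrite ext_map_scalarM // !ext_map_xiM ext_map_xi // !mulr0.
Qed.
End ExtMap.

Lemma xi_poly1_sum (J : finType) (F : J -> 'I_m -> P) :
  \sum_j xi_poly1 (F j) = xi_poly1 (fun a => \sum_j F j a).
Proof.
rewrite exchange_big; apply: eq_bigr => a _; rewrite raddf_sum mulr_suml.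
by apply: eq_bigr.
Qed.

Lemma xi_poly2_sum (J : finType) (F : J -> 'I_m -> 'I_m -> P) :
  \sum_j xi_poly2 (F j) = xi_poly2 (fun a b => \sum_j F j a b).
Proof.
rewrite exchange_big; apply: eq_bigr => a _; rewrite exchange_big; apply: eq_bigr => b _.
by rewrite raddf_sum mulr_suml; apply: eq_bigr.
Qed.

Lemma xi_poly3_sum (J : finType) (F : J -> 'I_m -> 'I_m -> 'I_m -> P) :
  \sum_j xi_poly3 (F j) = xi_poly3 (fun a b c => \sum_j F j a b c).
Proof.
rewrite exchange_big; apply: eq_bigr => a _; rewrite exchange_big; apply: eq_bigr => b _.
rewrite exchange_big; apply: eq_bigr => c _.
by rewrite raddf_sum mulr_suml; apply: eq_bigr.
Qed.

Lemma scalar_xi_poly1 c f : S c * xi_poly1 f = xi_poly1 (fun a => c * f a).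
Proof. by rewrite mulr_sumr; apply: eq_bigr => a _; rewrite rmorphM mulrA. Qed.

Lemma scalar_xi_poly2 c f : S c * xi_poly2 f = xi_poly2 (fun a b => c * f a b).
Proof.
rewrite mulr_sumr; apply: eq_bigr => a _; rewrite mulr_sumr; apply: eq_bigr => b _.
by rewrite rmorphM mulrA.
Qed.

Lemma scalar_xi_poly3 c f : S c * xi_poly3 f = xi_poly3 (fun a b d => c * f a b d).
Proof.
rewrite mulr_sumr; apply: eq_bigr => a _; rewrite mulr_sumr; apply: eq_bigr => b _.
by rewrite mulr_sumr; apply: eq_bigr => d _; rewrite rmorphM mulrA.
Qed.

Lemma xi_poly3D f g : xi_poly3 f + xi_poly3 g = xi_poly3 (fun a b c => f a b c + g a b c).
Proof.
rewrite -big_split; apply: eq_bigr => a _; rewrite -big_split; apply: eq_bigr => b _.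
by rewrite -big_split; apply: eq_bigr => c _; rewrite raddfD mulrDl.
Qed.

Lemma xi_poly1D f g : xi_poly1 f + xi_poly1 g = xi_poly1 (fun a => f a + g a).
Proof. by rewrite -big_split; apply: eq_bigr => a _; rewrite raddfD mulrDl. Qed.

Lemma xi_poly3_swap12 f : xi_poly3 (fun a b c => f b a c) = - xi_poly3 f.
Proof.
rewrite /xi_poly3 exchange_big -sumrN; apply: eq_bigr => b _; rewrite -sumrN.
apply: eq_bigr => a _; rewrite -sumrN; apply: eq_bigr => c _.
by rewrite (mulrA (xi a)) (xi_anticomm _ a b) mulNr mulrN -mulrA.
Qed.

Lemma xi_poly3_swap23 f : xi_poly3 (fun a b c => f a c b) = - xi_poly3 f.
Proof.
rewrite /xi_poly3 -sumrN; apply: eq_bigr => a _; rewrite exchange_big -sumrN.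
apply: eq_bigr => c _; rewrite -sumrN; apply: eq_bigr => b _.
by rewrite xi_anticomm !mulrN.
Qed.

Lemma xi_poly3N f : xi_poly3 (fun a b c => - f a b c) = - xi_poly3 f.
Proof.
rewrite -sumrN; apply: eq_bigr => a _; rewrite -sumrN; apply: eq_bigr => b _.
by rewrite -sumrN; apply: eq_bigr => c _; rewrite raddfN mulNr.
Qed.

Lemma xi_poly3_cycle f : xi_poly3 (fun a b c => f c a b) = xi_poly3 f.
Proof.
rewrite (xi_poly3_swap23 (fun a b c => f b a c)) (xi_poly3_swap12 f).
exact: opprK.
Qed.

Lemma xi_poly3_rev f : xi_poly3 (fun a b c => f c b a) = - xi_poly3 f.
Proof. by rewrite (xi_poly3_swap12 (fun a b c => f c a b)) xi_poly3_cycle. Qed.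

Lemma mul_xi_poly111 f g h : xi_poly1 f * (xi_poly1 g * xi_poly1 h) =
  xi_poly3 (fun a b c => f a * g b * h c).
Proof.
rewrite mulr_suml; apply: eq_bigr => a _; rewrite mulr_suml mulr_sumr; apply: eq_bigr => b _.
rewrite mulr_sumr mulr_sumr; apply: eq_bigr => c _.
rewrite !rmorphM -!mulrA; congr (_ * _).
by rewrite !(mulrA (xi _) (S _)) !ext_scalarC -!mulrA !(mulrA (xi _) (S _)) !ext_scalarC -!mulrA.
Qed.

Lemma mul_xi_poly12 f g : xi_poly1 f * xi_poly2 g = xi_poly3 (fun a b c => f a * g b c).
Proof.
rewrite mulr_suml; apply: eq_bigr => a _; rewrite mulr_sumr; apply: eq_bigr => b _.
rewrite mulr_sumr; apply: eq_bigr => c _.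
by rewrite rmorphM -!mulrA (mulrA (xi a) (S _)) ext_scalarC -!mulrA.
Qed.

Lemma mul_xi_poly21 f g : xi_poly2 f * xi_poly1 g = xi_poly3 (fun a b c => f a b * g c).
Proof.
rewrite mulr_suml; apply: eq_bigr => a _; rewrite mulr_suml; apply: eq_bigr => b _.
rewrite mulr_sumr; apply: eq_bigr => c _.
by rewrite rmorphM -!mulrA !(mulrA (xi _) (S _)) !ext_scalarC -!mulrA
  !(mulrA (xi _) (S _)) !ext_scalarC -!mulrA.
Qed.
Lemma xicoef_set0_poly1 f : xicoef (xi_poly1 f) set0 = 0.
Proof.
by rewrite xicoef_sum big1 // => a _; rewrite xicoef_set0M xicoef_set0_xi mulr0.
Qed.

Lemma xicoef_set0_poly2 f : xicoef (xi_poly2 f) set0 = 0.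
Proof.
rewrite xicoef_sum big1 // => a _; rewrite xicoef_sum big1 // => b _.
by rewrite !xicoef_set0M xicoef_set0_xi mul0r mulr0.
Qed.

Let d_xi0 a : d_xi a (0 : B) = 0.
Proof. by apply: (addrI (d_xi a (0 : B))); rewrite -d_xiD !addr0. Qed.

Let d_xi_sum a (J : finType) (F : J -> B) : d_xi a (\sum_j F j) = \sum_j d_xi a (F j).
Proof. exact: (big_morph (@d_xi P m a) (@d_xiD P m a) (d_xi0 a)). Qed.

Lemma d_xi_xi a b : d_xi a (xi b) = if a == b then 1 else 0 :> B.
Proof.
have := d_xi_xiM a b (1 : B); rewrite mulr1 => ->.
by rewrite -(rmorph1 (@ext_scalar P m)) d_xi_scalar mulr0 subr0.
Qed.

Let sum_if (V : nmodType) a (F : 'I_m -> V) : \sum_b (if a == b then F b else 0) = F a.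
Proof. by rewrite -big_mkcond (big_pred1 a) // => b; rewrite eq_sym. Qed.

Lemma d_xi_poly1 a f : d_xi a (xi_poly1 f) = S (f a).
Proof.
rewrite d_xi_sum -(sum_if a (fun b => S (f b))); apply: eq_bigr => b _.
by rewrite d_xi_scalarM d_xi_xi; case: eqP; rewrite ?mulr1 ?mulr0.
Qed.

Lemma d_xi_poly2 a f : d_xi a (xi_poly2 f) = xi_poly1 (fun b => f a b - f b a).
Proof.
have e b c : d_xi a (S (f b c) * (xi b * xi c)) =
    (if a == b then S (f b c) * xi c else 0) - (if a == c then S (f b c) * xi b else 0).
  rewrite d_xi_scalarM d_xi_xiM d_xi_xi mulrBr; congr (_ - _).
    by case: eqP; rewrite ?mulr0.
  by case: eqP; rewrite ?mulr0 // mulr1.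
rewrite d_xi_sum; under eq_bigr do rewrite d_xi_sum.
under eq_bigr do under eq_bigr do rewrite e.
under eq_bigr do rewrite sumrB sum_if.
rewrite sumrB exchange_big /=; under eq_bigr do rewrite sum_if.
by rewrite -sumrB; apply: eq_bigr => b _; rewrite raddfB mulrBl.
Qed.

Lemma d_xi_poly3 a f : d_xi a (xi_poly3 f) =
  xi_poly2 (fun b c => f a b c - f b a c + f b c a).
Proof.
have e b c d : d_xi a (S (f b c d) * (xi b * (xi c * xi d))) =
    (if a == b then S (f b c d) * (xi c * xi d) else 0)
    - (if a == c then S (f b c d) * (xi b * xi d) else 0)
    + (if a == d then S (f b c d) * (xi b * xi c) else 0).
  rewrite d_xi_scalarM !d_xi_xiM d_xi_xi mulrBr [X in _ - _ * X]mulrBr mulrBr opprB addrA.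
  rewrite addrAC; congr (_ - _ + _).
  - by case: eqP; rewrite ?mulr0.
  - by case: eqP; rewrite ?mulr0.
  - by case: eqP; rewrite ?mulr0 // mulr1.
rewrite d_xi_sum; under eq_bigr do rewrite d_xi_sum.
under eq_bigr do under eq_bigr do rewrite d_xi_sum.
under eq_bigr do under eq_bigr do under eq_bigr do rewrite e.
have e1 : \sum_b \sum_c \sum_d (if a == b then S (f b c d) * (xi c * xi d) else 0) =
    \sum_c \sum_d S (f a c d) * (xi c * xi d).
  rewrite exchange_big; apply: eq_bigr => c _; rewrite exchange_big.
  by apply: eq_bigr => d _; rewrite (sum_if a (fun b => S (f b c d) * (xi c * xi d))).
have e2 : \sum_b \sum_c \sum_d (if a == c then S (f b c d) * (xi b * xi d) else 0) =
    \sum_b \sum_d S (f b a d) * (xi b * xi d).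
  apply: eq_bigr => b _; rewrite exchange_big; apply: eq_bigr => d _.
  by rewrite (sum_if a (fun c => S (f b c d) * (xi b * xi d))).
have e3 : \sum_b \sum_c \sum_d (if a == d then S (f b c d) * (xi b * xi c) else 0) =
    \sum_b \sum_c S (f b c a) * (xi b * xi c).
  apply: eq_bigr => b _; apply: eq_bigr => c _.
  by rewrite (sum_if a (fun d => S (f b c d) * (xi b * xi c))).
do 2!under eq_bigr do under eq_bigr do rewrite big_split /=.
under eq_bigr do under eq_bigr do rewrite sumrN.
do 2!under eq_bigr do rewrite big_split /=.
under eq_bigr do rewrite sumrN.
rewrite !big_split /= sumrN e1 e2 e3 -sumrN -!big_split; apply: eq_bigr => b _ /=.
rewrite -sumrN -!big_split; apply: eq_bigr => c _ /=.
by rewrite raddfD raddfB mulrDl mulrBl.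
Qed.

Lemma grade_inv_poly1 f : grade_inv (xi_poly1 f) = - xi_poly1 f.
Proof.
rewrite /xi_poly1 (big_morph _ (@grade_invD P m) (grade_inv0 P m)) -sumrN.
by apply: eq_bigr => a _; rewrite grade_invM grade_inv_scalar grade_inv_xi mulrN.
Qed.

Lemma grade_inv_poly3 f : grade_inv (xi_poly3 f) = - xi_poly3 f.
Proof.
rewrite /xi_poly3 (big_morph _ (@grade_invD P m) (grade_inv0 P m)) -sumrN.
apply: eq_bigr => a _; rewrite (big_morph _ (@grade_invD P m) (grade_inv0 P m)) -sumrN.
apply: eq_bigr => b _; rewrite (big_morph _ (@grade_invD P m) (grade_inv0 P m)) -sumrN.
apply: eq_bigr => c _; rewrite !grade_invM grade_inv_scalar !grade_inv_xi.
by rewrite !(mulrN, mulNr) opprK.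
Qed.
End XiPolynomials.

(** * The bracket over an abstract coefficient ring and its Hamiltonian vector fields *)

Section PhaseSpace.
Variables (P : comNzRingType) (n m : nat) (Dx Dp : 'I_n -> P -> P).
Variable Ki : 'I_m -> 'I_m -> P.

Hypothesis DxD : forall mu u v, Dx mu (u + v) = Dx mu u + Dx mu v.
Hypothesis DpD : forall mu u v, Dp mu (u + v) = Dp mu u + Dp mu v.
Hypothesis DxM : forall mu u v, Dx mu (u * v) = Dx mu u * v + u * Dx mu v.
Hypothesis DpM : forall mu u v, Dp mu (u * v) = Dp mu u * v + u * Dp mu v.
Hypothesis DxC : forall mu nu u, Dx mu (Dx nu u) = Dx nu (Dx mu u).
Hypothesis DpC : forall mu nu u, Dp mu (Dp nu u) = Dp nu (Dp mu u).
Hypothesis DxpC : forall mu nu u, Dx mu (Dp nu u) = Dp nu (Dx mu u).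
Hypothesis Ki_sym : forall a b, Ki a b = Ki b a.
Hypothesis Dx_Ki : forall mu a b, Dx mu (Ki a b) = 0.
Hypothesis Dp_Ki : forall mu a b, Dp mu (Ki a b) = 0.
Hypothesis torsion2P : forall u : P, u + u = 0 -> u = 0.

Notation B := (exterior P m).
Notation S := (ext_scalar m).

Definition ext_bracket (f g : B) : B :=
  \sum_(mu < n) (ext_map (Dx mu) f * ext_map (Dp mu) g
                 - ext_map (Dp mu) f * ext_map (Dx mu) g)
  + \sum_(a < m) \sum_(b < m) d_xi a (grade_inv f) * S (Ki a b) * d_xi b g.

(** Applied with e the indicator function of U, to see that the bracket vanishes off U when its
    first argument does. *)
Lemma ext_bracketMl e f g : (forall mu, Dx mu e = 0) -> (forall mu, Dp mu e = 0) ->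
  ext_bracket (S e * f) g = S e * ext_bracket f g.
Proof.
move=> Dxe Dpe; rewrite /ext_bracket mulrDr !mulr_sumr; congr (_ + _).
  apply: eq_bigr => mu _; rewrite !ext_mapM // !ext_map_scalar //.
  by rewrite Dxe Dpe raddf0 !mul0r !add0r mulrBr !mulrA.
apply: eq_bigr => a _; rewrite mulr_sumr; apply: eq_bigr => b _.
by rewrite grade_invM grade_inv_scalar d_xi_scalarM !mulrA.
Qed.

(* The coordinates x, xi, p in this order. *)
Definition coord : finType := ('I_n + 'I_m + 'I_n)%type.

Definition coord_parity (i : coord) : bool := if i is inl (inr _) then true else false.

Definition coord_deriv (i : coord) : B -> B :=
  match i with
  | inl (inl mu) => ext_map (Dx mu)
  | inl (inr a) => @d_xi P m a
  | inr mu => ext_map (Dp mu)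
  end.

Local Notation par := coord_parity.
Local Notation d := coord_deriv.

Section HamiltonianField.
Variable H : B.
Hypothesis H_odd : grade_inv H = - H.
Hypothesis master : ext_bracket H H = 0.

(** The components of {H, -}. The minus sign in the xi-component is the factor (-1)^k of the
    bracket, H being odd. *)
Definition hvector (i : coord) : B :=
  match i with
  | inl (inl mu) => - ext_map (Dp mu) H
  | inl (inr b) => - \sum_(a < m) d_xi a H * S (Ki a b)
  | inr mu => ext_map (Dx mu) H
  end.

Local Notation X := hvector.
Local Notation odd_part := (has_parity (@grade_inv P m)).
Local Notation Q := (vfield d X).

Let giD : {morph @grade_inv P m : f g / f + g}.
Proof. by move=> f g; exact: grade_invD. Qed.

Let gi0 : grade_inv 0 = 0 :> B.
Proof. by apply: (addrI (grade_inv 0 : B)); rewrite -giD !addr0. Qed.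

Let giN (f : B) : grade_inv (- f) = - grade_inv f.
Proof. by apply/eqP; rewrite -addr_eq0 -giD addNr gi0. Qed.

Let gi_sum (J : finType) (F : J -> B) : grade_inv (\sum_j F j) = \sum_j grade_inv (F j).
Proof. exact: (big_morph (@grade_inv P m) giD gi0). Qed.

Lemma coord_derivD i (f g : B) : d i (f + g) = d i f + d i g.
Proof. by case: i => [[mu|a]|mu]; [exact: ext_mapD|exact: d_xiD|exact: ext_mapD]. Qed.

Lemma coord_deriv0 i : d i 0 = 0.
Proof. by apply: (addrI (d i 0)); rewrite -coord_derivD !addr0. Qed.

Lemma coord_derivN i (f : B) : d i (- f) = - d i f.
Proof. by apply/eqP; rewrite -addr_eq0 -coord_derivD addNr coord_deriv0. Qed.

Lemma coord_deriv_sum i (J : finType) (F : J -> B) : d i (\sum_j F j) = \sum_j d i (F j).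
Proof. exact: (big_morph (d i) (coord_derivD i) (coord_deriv0 i)). Qed.

Lemma coord_derivM i b (f g : B) : odd_part b f ->
  d i (f * g) = d i f * g + (-1) ^+ (par i && b) * (f * d i g).
Proof.
case: i => [[mu|a]|mu] hf /=; first by rewrite mul1r ext_mapM.
  by rewrite d_xiM hf -mulrA.
by rewrite mul1r ext_mapM.
Qed.

Lemma coord_derivC i j (f : B) :
  d i (d j f) = (-1) ^+ (par i && par j) * d j (d i f).
Proof.
case: i j => [[mu|a]|mu] [[nu|b]|nu] /=; rewrite ?mul1r ?mulN1r.
- exact: ext_mapC.
- exact: ext_map_d_xi.
- exact: ext_mapC.
- by rewrite ext_map_d_xi.
- exact: d_xi_anticomm.
- by rewrite ext_map_d_xi.
- by rewrite (ext_mapC f (fun c => esym (DxpC nu mu c))).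
- exact: ext_map_d_xi.
- exact: ext_mapC.
Qed.

Lemma grade_inv_coord_deriv i (f : B) : grade_inv (d i f) = (-1) ^+ par i * d i (grade_inv f).
Proof.
case: i => [[mu|a]|mu] /=; rewrite ?mul1r ?mulN1r.
- by rewrite ext_map_grade_inv.
- exact: grade_inv_d_xi.
- by rewrite ext_map_grade_inv.
Qed.

Lemma coord_deriv_parity i b (f : B) : odd_part b f -> odd_part (b (+) par i) (d i f).
Proof.
rewrite /has_parity grade_inv_coord_deriv => ->.
by case: b; case: (par i); rewrite /= ?expr0 ?expr1 ?mul1r ?mulN1r ?coord_derivN ?opprK.
Qed.

Let dH_parity i : odd_part (~~ par i) (d i H).
Proof. by apply: (@coord_deriv_parity i true); rewrite /has_parity H_odd mulN1r. Qed.

Lemma hvector_parity i : odd_part (~~ par i) (X i).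
Proof.
case: i => [[mu|b]|mu].
- apply/has_parity_odd; apply: etrans (giN _) _; congr (- _).
  by apply/has_parity_odd; exact: (dH_parity (inr mu)).
- apply/has_parity_even; apply: etrans (giN _) _; congr (- _).
  apply: etrans (gi_sum _) _; apply: eq_bigr => a _.
  rewrite grade_invM grade_inv_scalar; congr (_ * _).
  by apply/has_parity_even; exact: (dH_parity (inl (inr a))).
- exact: (dH_parity (inl (inl mu))).
Qed.

Lemma vfield_hvectorE f : Q f =
  \sum_mu (d (inl (inl mu)) H * d (inr mu) f - d (inr mu) H * d (inl (inl mu)) f)
  - \sum_a \sum_b d (inl (inr a)) H * S (Ki a b) * d (inl (inr b)) f.
Proof.
rewrite /vfield !big_sumType /= big_split addrAC /=; congr (_ + _).
  by rewrite addrC; congr (_ + _); apply: eq_bigr => mu _; rewrite mulNr.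
rewrite exchange_big -sumrN; apply: eq_bigr => b _.
by rewrite mulNr mulr_suml.
Qed.

Lemma ext_bracketE f : ext_bracket H f = Q f.
Proof.
rewrite vfield_hvectorE /ext_bracket; congr (_ + _).
rewrite -sumrN; apply: eq_bigr => a _; rewrite -sumrN; apply: eq_bigr => b _.
by rewrite H_odd [d_xi a (- H)](coord_derivN (inl (inr a))) !mulNr.
Qed.

Let QH : Q H = 0. Proof. by rewrite -ext_bracketE. Qed.

Let torsion2 (f : B) : f + f = 0 -> f = 0.
Proof.
move=> e; apply: xicoefP => U; rewrite xicoef0; apply: torsion2P.
by rewrite -xicoefD e xicoef0.
Qed.

Let d_Ki i a b : d i (S (Ki a b)) = 0.
Proof.
case: i => [[mu|c]|mu] /=; last 1 first.
- by rewrite ext_map_scalar ?Dp_Ki ?raddf0 // -(DpD mu 0 0).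
- by rewrite ext_map_scalar ?Dx_Ki ?raddf0.
- by rewrite d_xi_scalar.
Qed.

Local Arguments coord_deriv : simpl never.

Let dHM i j f :
  d i (d j H * f) = d i (d j H) * f + (-1) ^+ (par i && ~~ par j) * (d j H * d i f).
Proof. exact: coord_derivM. Qed.

(** Q H is quadratic in H, and the bracket is symmetric on odd elements. So [d i], acting on either
    copy of H in Q H = 0, gives the same term Q (d_i H) up to the common sign (-1)^(par i), and 2
    can be cancelled. *)
Lemma vfield_deriv_H i : Q (d i H) = 0.
Proof.
suff e : d i (Q H) = (-1) ^+ par i * (Q (d i H) + Q (d i H)).
  apply: torsion2; have := congr1 (fun f => (-1) ^+ par i * f) e.
  by rewrite QH coord_deriv0 mulr0 mulrA -expr2 sqrr_sign mul1r => <-.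
rewrite !vfield_hvectorE coord_derivD coord_derivN addrACA -opprD mulrDr mulrN.
congr (_ - _).
  rewrite !coord_deriv_sum -big_split mulr_sumr /=; apply: eq_bigr => mu _.
  set x := inl (inl mu); set p := inr mu.
  (* The term in which [d i] hits the first factor is reordered: [d j (d i H)] has parity 1 + par i
     and passes the odd [d k H]. The difference of the cases (x, p) and (p, x) then contains every
     term of Q (d_i H) twice. *)
  have oxp (j k : coord) : ~~ par j -> ~~ par k ->
      d i (d j H * d k H) = (-1) ^+ par i * (d j H * d k (d i H))
                          - (-1) ^+ par i * (d k H * d j (d i H)).
    move=> /negPf pj /negPf pk; rewrite dHM (coord_derivC i j) (coord_derivC i k) pj pk !andbF.
    rewrite !mul1r andbT addrC; congr (_ + _).
    have := exterior_supercomm (coord_deriv_parity j (coord_deriv_parity i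
      (_ : odd_part true H))) (dH_parity k).
    rewrite pj pk addbF => ->; last by apply/has_parity_odd.
    by rewrite andbT /= -mulNr; case: (par i); rewrite /= ?expr0 ?expr1 ?opprK.
  rewrite coord_derivD coord_derivN !oxp // opprB mulrDr !mulrDr !mulrN.
  by rewrite addrACA [X in _ + X]addrC.
(* The two terms differ by exchanging a and b, hence agree after summation; this uses the symmetry
   of [Ki]. *)
have ohh a b : d i (d (inl (inr a)) H * S (Ki a b) * d (inl (inr b)) H) =
    (-1) ^+ par i * (d (inl (inr b)) H * S (Ki b a) * d (inl (inr a)) (d i H))
  + (-1) ^+ par i * (d (inl (inr a)) H * S (Ki a b) * d (inl (inr b)) (d i H)).
  rewrite -mulrA dHM /= andbF mul1r (coord_derivC i (inl (inr a))) andbT.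
  have hS : odd_part false (S (Ki a b)) by apply/has_parity_even; exact: grade_inv_scalar.
  rewrite (coord_derivM i _ hS) d_Ki mul0r add0r andbF mul1r.
  rewrite (coord_derivC i (inl (inr b))) /= andbT.
  congr (_ + _); last by rewrite !mulrA !(commr_sign _ (par i)) !mulrA.
  rewrite -!mulrA; congr (_ * _).
  have ha : odd_part (true (+) par i (+) true) (d (inl (inr a)) (d i H)).
    by apply/coord_deriv_parity/coord_deriv_parity/has_parity_odd.
  have hb : odd_part false (S (Ki a b) * d (inl (inr b)) H).
    by have := has_parityM (@grade_invM P m) hS (dH_parity (inl (inr b))).
  by rewrite (exterior_supercomm ha hb) andbF mul1r -Ki_sym mulrA ext_scalarC.
rewrite coord_deriv_sum mulrDr; under eq_bigr do rewrite coord_deriv_sum.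
under eq_bigr do under eq_bigr do rewrite ohh.
under eq_bigr do rewrite big_split /=.
rewrite big_split /= exchange_big /=.
congr (_ + _); rewrite mulr_sumr; apply: eq_bigr => a _; rewrite mulr_sumr;
  by apply: eq_bigr => b _.
Qed.

(** Up to signs and the constants [Ki], the components of X are derivatives of H. *)
Lemma vfield_hvector j : Q (X j) = 0.
Proof.
have QD f g : Q (f + g) = Q f + Q g by apply: vfieldD; exact: coord_derivD.
have Q0 : Q 0 = 0 by apply: (addrI (Q 0)); rewrite -QD !addr0.
have QN f : Q (- f) = - Q f by apply/eqP; rewrite -addr_eq0 -QD addNr Q0.
case: j => [[mu|b]|mu].
- by rewrite QN [Q _](vfield_deriv_H (inr mu)) oppr0.
- rewrite QN (big_morph Q QD Q0) big1 ?oppr0 // => a _.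
  have := vfieldM (@exterior_supercomm P m) coord_derivM hvector_parity (S (Ki a b))
    (dH_parity (inl (inr a))).
  rewrite /= => ->; rewrite [Q (d_xi a H)](vfield_deriv_H (inl (inr a))) mul0r add0r.
  rewrite /vfield big1 ?mulr0 // => k _; by rewrite d_Ki mulr0.
- exact: (vfield_deriv_H (inl (inl mu))).
Qed.

Lemma bracket_cube_trace : ext_bracket H (cube_trace d X) = 0.
Proof.
rewrite ext_bracketE.
apply: (vfield_cube_trace (@grade_invM P m) (@exterior_supercomm P m) coord_derivD
  coord_derivM coord_derivC coord_deriv_parity hvector_parity vfield_hvector).
- exact: grade_invD.
- exact: torsion2.
Qed.
End HamiltonianField.

(** * The Hamiltonian built from rho and T, and the entries of its Jacobian *)

Section CubicHamiltonian.
Variables (pv : 'I_n -> P) (rho : 'I_m -> 'I_n -> P) (T : 'I_m -> 'I_m -> 'I_m -> P).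
Variable sixth : P.
Hypothesis sixthE : sixth *+ 6 = 1.
Hypothesis Dx_sixth : forall mu, Dx mu sixth = 0.
Hypothesis Dp_sixth : forall mu, Dp mu sixth = 0.
Hypothesis Dx_pv : forall mu nu, Dx mu (pv nu) = 0.
Hypothesis Dp_pv : forall mu nu, Dp mu (pv nu) = (mu == nu)%:R.
Hypothesis Dp_rho : forall mu a nu, Dp mu (rho a nu) = 0.
Hypothesis Dp_T : forall mu a b c, Dp mu (T a b c) = 0.
Hypothesis T_skew12 : forall a b c, T b a c = - T a b c.
Hypothesis T_skew23 : forall a b c, T a c b = - T a b c.

Local Notation xi := (xi P).
Local Notation x mu := (inl (inl mu) : coord).
Local Notation y a := (inl (inr a) : coord).
Local Notation p mu := (inr mu : coord).

Definition rho_p a : P := \sum_mu rho a mu * pv mu.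

Definition cubic_hamiltonian : B :=
  xi_poly1 rho_p + xi_poly3 (fun a b c => sixth * T a b c).

Definition half : P := sixth *+ 3.

Definition raised_rho b mu : P := \sum_c Ki b c * rho c mu.

Definition raised_T a b c : P := \sum_d Ki c d * T a b d.

Local Notation H := cubic_hamiltonian.

Lemma scalar_cubic_hamiltonian e : (forall a mu, e * rho a mu = rho a mu) ->
  (forall a b c, e * T a b c = T a b c) -> S e * H = H.
Proof.
move=> e_rho e_T; rewrite mulrDr scalar_xi_poly1 scalar_xi_poly3; congr (_ + _).
  apply: eq_xi_poly1 => a; rewrite mulr_sumr; apply: eq_bigr => mu _.
  by rewrite mulrA e_rho.
by apply: eq_xi_poly3 => a b c; rewrite mulrCA e_T.
Qed.

Lemma half2 u : half * u + half * u = u.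
Proof. by rewrite -mulrDl /half -mulrnDr sixthE mul1r. Qed.

Let Dp0 mu : Dp mu 0 = 0.
Proof. by apply: (addrI (Dp mu 0)); rewrite -DpD !addr0. Qed.

Let Dx0 mu : Dx mu 0 = 0.
Proof. by apply: (addrI (Dx mu 0)); rewrite -DxD !addr0. Qed.

Let Dx_half mu : Dx mu half = 0.
Proof. by rewrite /half !mulrS !DxD !Dx_sixth Dx0 !addr0. Qed.

Lemma Dx_rho_p mu a : Dx mu (rho_p a) = \sum_nu Dx mu (rho a nu) * pv nu.
Proof.
rewrite (deriv_sum (DxD mu)); apply: eq_bigr => nu _.
by rewrite DxM Dx_pv mulr0 addr0.
Qed.

Lemma Dp_rho_p mu a : Dp mu (rho_p a) = rho a mu.
Proof.
rewrite (deriv_sum (DpD mu)) (bigD1 mu) //= big1 => [|nu nmu].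
  by rewrite DpM Dp_rho Dp_pv eqxx mul0r add0r mulr1 addr0.
by rewrite DpM Dp_rho Dp_pv eq_sym (negPf nmu) mul0r mulr0 addr0.
Qed.

(** Normalised so that [bivector (T a)] is the T-part of [d_xi a H]: the three positions of xi^a in
    the cubic term contribute equally, and three sixths make a half. *)
Definition bivector (f : 'I_m -> 'I_m -> P) : B := xi_poly2 (fun a b => half * f a b).

Lemma cubic_hamiltonian_odd : grade_inv H = - H.
Proof. by rewrite grade_invD grade_inv_poly1 grade_inv_poly3 opprD. Qed.

Lemma Dp_cubic mu : ext_map (Dp mu) H = xi_poly1 (fun a => rho a mu).
Proof.
rewrite ext_mapD // ext_map_poly1 // ext_map_poly3 //.
rewrite (eq_xi_poly1 (Dp_rho_p mu)) [X in _ + X]big1 ?addr0 // => a _.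
rewrite big1 // => b _; rewrite big1 // => c _.
by rewrite DpM Dp_sixth Dp_T mul0r mulr0 addr0 raddf0 mul0r.
Qed.

Lemma d_xi_cubic a : d_xi a H = S (rho_p a) + bivector (T a).
Proof.
rewrite d_xiD d_xi_poly1 d_xi_poly3; congr (_ + _); apply: eq_xi_poly2 => b c.
by rewrite /half T_skew12 (T_skew23 b) T_skew12; ring.
Qed.

Lemma Dx_d_xi_cubic mu a : ext_map (Dx mu) (d_xi a H) =
  S (\sum_nu Dx mu (rho a nu) * pv nu) + bivector (fun b c => Dx mu (T a b c)).
Proof.
rewrite d_xi_cubic ext_mapD // ext_map_scalar // Dx_rho_p ext_map_poly2 //.
by congr (_ + _); apply: eq_xi_poly2 => b c; rewrite DxM Dx_half mul0r add0r.
Qed.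

Lemma d_xi_d_xi_cubic a c : d_xi a (d_xi c H) = xi_poly1 (fun d => T c a d).
Proof.
rewrite d_xi_cubic d_xiD d_xi_scalar add0r d_xi_poly2; apply: eq_xi_poly1 => d.
by rewrite (T_skew23 c a d) mulrN opprK half2.
Qed.

Local Notation X := (hvector H).
Local Notation M := (jacobian d X).

Local Notation D mu nu := (xi_poly1 (fun a => Dx mu (rho a nu))).

Lemma jacobian_xx mu nu : M (x mu) (x nu) = - D mu nu.
Proof.
rewrite /jacobian /= [ext_map _ (- _)](coord_derivN (x mu)) /= Dp_cubic.
by rewrite ext_map_poly1.
Qed.

(** H is linear in p, so its second p-derivatives vanish. *)
Lemma jacobian_px mu nu : M (p mu) (x nu) = 0.
Proof.
rewrite /jacobian /= [ext_map _ (- _)](coord_derivN (p mu)) /= Dp_cubic.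
rewrite ext_map_poly1 // [X in - X]big1 ?oppr0 // => a _.
by rewrite Dp_rho raddf0 mul0r.
Qed.

Lemma jacobian_yx a nu : M (y a) (x nu) = - S (rho a nu).
Proof.
rewrite /jacobian /= [d_xi a (- _)](coord_derivN (y a)) /= Dp_cubic.
by rewrite d_xi_poly1.
Qed.

Lemma jacobian_pp mu nu : M (p mu) (p nu) = D nu mu.
Proof.
rewrite /jacobian /= (ext_mapC H (fun c => esym (DxpC nu mu c))) Dp_cubic.
by rewrite ext_map_poly1.
Qed.

Let jacobian_y i b : M i (y b) =
  - \sum_a d i (d_xi a H) * S (Ki a b).
Proof.
rewrite /jacobian /= coord_derivN coord_deriv_sum; congr (- _); apply: eq_bigr => a _.
have e : d i (S (Ki a b)) = 0.
  by case: i => [[mu|c]|mu] /=; rewrite ?d_xi_scalar // ext_map_scalar ?Dx_Ki ?Dp_Ki ?raddf0.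
have h : has_parity (@grade_inv P m) (false : bool) (d_xi a H).
  apply/has_parity_even; rewrite grade_inv_d_xi cubic_hamiltonian_odd.
  by rewrite [d_xi a (- _)](coord_derivN (y a)) opprK.
by rewrite (coord_derivM i _ h) e mulr0 mulr0 addr0.
Qed.

Lemma jacobian_py mu b : M (p mu) (y b) = - S (raised_rho b mu).
Proof.
rewrite jacobian_y; congr (- _); rewrite [RHS]raddf_sum; apply: eq_bigr => a _.
by rewrite /= ext_map_d_xi // Dp_cubic d_xi_poly1 -rmorphM mulrC Ki_sym.
Qed.

Lemma jacobian_yy a b : M (y a) (y b) = - xi_poly1 (fun d => raised_T a d b).
Proof.
rewrite jacobian_y -(xi_poly1_sum (fun c d => Ki b c * T a d c)); congr (- _).
apply: eq_bigr => c _.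
rewrite /= d_xi_d_xi_cubic ext_scalarC scalar_xi_poly1; apply: eq_xi_poly1 => e.
by rewrite Ki_sym (T_skew12 a c) (T_skew23 a e c) opprK.
Qed.

Local Notation Bb mu b := (S (\sum_la Dx mu (raised_rho b la) * pv la)
  + bivector (fun d e => Dx mu (raised_T d e b))).

Lemma jacobian_xy mu b : M (x mu) (y b) = - Bb mu b.
Proof.
rewrite jacobian_y; congr (- _).
under eq_bigr do rewrite /= Dx_d_xi_cubic ext_scalarC mulrDr scalar_xi_poly2.
rewrite big_split xi_poly2_sum; congr (_ + _); last first.
  apply: eq_xi_poly2 => e f; rewrite (deriv_sum (DxD mu)) big_distrr; apply: eq_bigr => c _.
  by rewrite DxM Dx_Ki mul0r add0r (T_skew12 e) (T_skew23 e) opprK Ki_sym mulrCA.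
rewrite (_ : \sum_la _ = \sum_a Ki a b * \sum_nu Dx mu (rho a nu) * pv nu).
  by rewrite raddf_sum; apply: eq_bigr => a _ /=; rewrite rmorphM.
under eq_bigr do rewrite (deriv_sum (DxD mu)) big_distrl /=.
rewrite exchange_big; apply: eq_bigr => a _; rewrite mulr_sumr; apply: eq_bigr => la _.
by rewrite DxM Dx_Ki mul0r add0r Ki_sym mulrA.
Qed.

(** The product of the first two entries has parity par i + par k and the third entry has the
    opposite parity, so one of them is even. This makes the block traces below invariant under
    rotation. *)
Let jacobian_comm i j k : M i j * M j k * M k i = M k i * (M i j * M j k).
Proof.
have par_M i' j' := jacobian_parity coord_deriv_parity (hvector_parity cubic_hamiltonian_odd) i' j'.
have := exterior_supercomm (has_parityM (@grade_invM P m) (par_M i j) (par_M j k)) (par_M k i).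
by move->; case: (par i); case: (par j); case: (par k); rewrite mul1r.
Qed.

(** * Decomposition of the cube trace by the kinds of coordinates along a cycle *)

Definition block_trace (I J K : finType) (f : I -> coord) (g : J -> coord)
    (h : K -> coord) : B :=
  \sum_i \sum_j \sum_k M (f i) (g j) * M (g j) (h k) * M (h k) (f i).

Lemma block_trace_rot (I J K : finType) (f : I -> coord) (g : J -> coord) (h : K -> coord) :
  block_trace f g h = block_trace h f g.
Proof.
rewrite /block_trace; under eq_bigr do rewrite exchange_big.
rewrite exchange_big; apply: eq_bigr => k _; apply: eq_bigr => i _; apply: eq_bigr => j _.
by rewrite jacobian_comm mulrA.
Qed.

Local Notation x_ := (fun mu : 'I_n => x mu).
Local Notation y_ := (fun a : 'I_m => y a).
Local Notation p_ := (fun mu : 'I_n => p mu).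

Lemma sum_coord (F : coord -> B) :
  \sum_i F i = \sum_mu F (x mu) + \sum_a F (y a) + \sum_mu F (p mu).
Proof. by rewrite !big_sumType. Qed.

Lemma block_trace_px (I : finType) (f : I -> coord) : block_trace p_ x_ f = 0.
Proof.
by rewrite /block_trace big1 // => mu _; rewrite big1 // => nu _; rewrite big1 // => i _;
  rewrite jacobian_px !mul0r.
Qed.

(** The 27 words of length three in x, y, p fall under rotation into three constant words and eight
    classes of three words. The classes of xxp, xpp and xyp contain a step from p to x and vanish;
    five classes remain, each counted three times. *)
Lemma cube_trace_blocks : cube_trace d X =
  block_trace x_ x_ x_ + block_trace y_ y_ y_ + block_trace p_ p_ p_
  + (block_trace x_ x_ y_ + block_trace x_ y_ y_ + block_trace y_ p_ p_
     + block_trace y_ p_ y_ + block_trace x_ p_ y_) *+ 3.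
Proof.
rewrite /cube_trace.
have e (I J : finType) (f : I -> coord) (g : J -> coord) :
    \sum_i \sum_j \sum_k M (f i) (g j) * M (g j) k * M k (f i) =
    block_trace f g x_ + block_trace f g y_ + block_trace f g p_.
  rewrite -!big_split; apply: eq_bigr => i _; rewrite -!big_split; apply: eq_bigr => j _.
  by rewrite sum_coord.
have e' (I : finType) (f : I -> coord) :
    \sum_i \sum_j \sum_k M (f i) j * M j k * M k (f i) =
    (block_trace f x_ x_ + block_trace f x_ y_ + block_trace f x_ p_) +
    (block_trace f y_ x_ + block_trace f y_ y_ + block_trace f y_ p_) +
    (block_trace f p_ x_ + block_trace f p_ y_ + block_trace f p_ p_).
  by rewrite -!e -!big_split; apply: eq_bigr => i _; rewrite sum_coord.
rewrite sum_coord (e' _ x_) (e' _ y_) (e' _ p_).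
have rot := block_trace_rot; have px := block_trace_px.
rewrite !px (rot _ _ _ x_ x_ p_) (rot _ _ _ x_ y_ p_) (rot _ _ _ p_ p_ x_) (rot _ _ _ x_ p_ p_) !px.
rewrite (rot _ _ _ x_ p_ x_) (rot _ _ _ x_ x_ p_) (rot _ _ _ y_ p_ x_) (rot _ _ _ x_ y_ p_) !px.
rewrite (rot _ _ _ y_ x_ x_) (rot _ _ _ x_ y_ x_) (rot _ _ _ y_ x_ y_) (rot _ _ _ y_ y_ x_).
rewrite (rot _ _ _ p_ y_ p_) (rot _ _ _ p_ p_ y_) (rot _ _ _ y_ y_ p_) (rot _ _ _ p_ y_ y_).
rewrite (rot _ _ _ y_ x_ p_) (rot _ _ _ p_ y_ x_).
rewrite !mulrS mulr0n; apply: xicoefP => U; rewrite !(xicoefD, xicoef0).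
ring.
Qed.

(** In xi-degree zero the x-p part of the bracket drops out, since [ext_map (Dp mu) H] is linear in
    xi. There remains, up to sign, the quadratic form W in p, whose coefficients are the required
    sums. *)
Lemma master_rho_null mu nu : ext_bracket H H = 0 ->
  \sum_a \sum_b Ki a b * rho a mu * rho b nu = 0.
Proof.
move=> master; pose W := \sum_a \sum_b Ki a b * (rho_p a * rho_p b).
have W0 : W = 0.
  have dxi0 a : xicoef (d_xi a H) set0 = rho_p a.
    by rewrite d_xi_cubic xicoefD xicoef_set0_poly2 xicoef_scalar eqxx addr0.
  have := congr1 (fun f => xicoef f set0) master.
  rewrite ext_bracketE ?cubic_hamiltonian_odd // vfield_hvectorE.
  rewrite xicoefD xicoefN !xicoef_sum xicoef0 big1 ?add0r => [/eqP|la _]; last first.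
    rewrite /= !Dp_cubic xicoefD xicoefN !xicoef_set0M !xicoef_set0_poly1.
    by rewrite mulr0 mul0r subr0.
  rewrite oppr_eq0 => /eqP e; rewrite /W -[RHS]e; apply: eq_bigr => a _.
  rewrite xicoef_sum; apply: eq_bigr => b _ /=.
  rewrite !xicoef_set0M !dxi0 xicoef_scalar eqxx; ring.
(* Two p-derivatives extract the coefficient of p_mu p_nu; it appears twice because [Ki] is
   symmetric. *)
have DW : Dp nu (Dp mu W) = \sum_a \sum_b Ki a b * rho a mu * rho b nu
    + \sum_a \sum_b Ki a b * rho a mu * rho b nu.
  rewrite [X in _ + X]exchange_big -big_split (deriv_sum (DpD mu)) (deriv_sum (DpD nu)).
  apply: eq_bigr => a _; rewrite -big_split (deriv_sum (DpD mu)) (deriv_sum (DpD nu)).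
  apply: eq_bigr => b _ /=.
  rewrite !(DpM, DpD, Dp0, Dp_Ki, Dp_rho_p, Dp_rho, mul0r, mulr0, add0r, addr0).
  rewrite (Ki_sym b a); ring.
by apply: torsion2P; rewrite -DW W0 !Dp0.
Qed.

Hypothesis rho_null : forall mu nu, \sum_a \sum_b Ki a b * rho a mu * rho b nu = 0.

Definition rho_chain a b c : P := \sum_mu \sum_nu \sum_la
  Dx mu (rho a nu) * Dx nu (rho b la) * Dx la (rho c mu).

Definition T_chain a b c : P := \sum_d \sum_e \sum_f
  raised_T d a e * raised_T e b f * raised_T f c d.

Definition raised2_T a b c : P := \sum_d \sum_e Ki b d * Ki c e * T a d e.

(** [rho_dot1] and [rho_dot2] mirror the two sums in [rho_dot], and [T_dot1] and [T_dot2] the two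
    skewsymmetrised sums in [T_dot]. *)
Definition rho_dot1 a mu : P := \sum_b \sum_la \sum_nu
  rho b la * Dx la (rho a nu) * Dx nu (raised_rho b mu).

Definition rho_dot2 a mu : P := \sum_b \sum_c \sum_la
  rho b la * Dx la (rho c mu) * raised2_T a b c.

Definition T_dot1 a b c : P := \sum_d \sum_mu \sum_nu
  rho d mu * Dx mu (rho a nu) * Dx nu (raised_T b c d).

Definition T_dot2 a b c : P := \sum_d \sum_e \sum_mu
  rho d mu * raised2_T a d e * Dx mu (T b c e).

Lemma block_trace_xxx : block_trace x_ x_ x_ = - xi_poly3 rho_chain.
Proof.
rewrite -xi_poly3_sum -sumrN; apply: eq_bigr => mu _; rewrite -xi_poly3_sum -sumrN.
apply: eq_bigr => nu _; rewrite -xi_poly3_sum -sumrN; apply: eq_bigr => la _.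
by rewrite !jacobian_xx mulrNN mulrN -mulrA mul_xi_poly111.
Qed.

(** The pp block is the transpose of D, so the cycle runs backwards, and reversing three generators
    costs the sign -. The xx block is -D, so both constant words give the same contribution. *)
Lemma block_trace_ppp : block_trace p_ p_ p_ = - xi_poly3 rho_chain.
Proof.
rewrite -xi_poly3_rev -xi_poly3_sum; apply: eq_bigr => mu _.
rewrite -xi_poly3_sum exchange_big; apply: eq_bigr => la _.
rewrite -xi_poly3_sum; apply: eq_bigr => nu _.
rewrite !jacobian_pp -mulrA mul_xi_poly111; apply: eq_xi_poly3 => a b c; ring.
Qed.

Lemma block_trace_yyy : block_trace y_ y_ y_ = - xi_poly3 T_chain.
Proof.
rewrite -xi_poly3_sum -sumrN; apply: eq_bigr => d _; rewrite -xi_poly3_sum -sumrN.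
apply: eq_bigr => e _; rewrite -xi_poly3_sum -sumrN; apply: eq_bigr => f _.
by rewrite !jacobian_yy mulrNN mulrN -mulrA mul_xi_poly111.
Qed.

Lemma mul_poly1_bivector f u g r : xi_poly1 f * (S u + bivector g) * S r =
  xi_poly1 (fun a => f a * u * r) + xi_poly3 (fun a b c => half * (f a * g b c * r)).
Proof.
rewrite ext_scalarC mulrDr mul_xi_poly12 (ext_scalarC u) mulrDr !scalar_xi_poly1.
rewrite scalar_xi_poly3; congr (_ + _); first by apply: eq_xi_poly1 => a; ring.
by apply: eq_xi_poly3 => a b c; ring.
Qed.

Lemma mul_bivector_poly1 f u g r : (S u + bivector g) * xi_poly1 f * S r =
  xi_poly1 (fun a => f a * u * r) + xi_poly3 (fun a b c => half * (g a b * f c * r)).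
Proof.
rewrite ext_scalarC mulrDl mul_xi_poly21 mulrDr !scalar_xi_poly1.
rewrite scalar_xi_poly3; congr (_ + _); first by apply: eq_xi_poly1 => a; ring.
by apply: eq_xi_poly3 => a b c; ring.
Qed.

Lemma sum_rot3 (V : nmodType) (I J K : finType) (F : I -> J -> K -> V) :
  \sum_i \sum_j \sum_k F i j k = \sum_k \sum_i \sum_j F i j k.
Proof. by under eq_bigr do rewrite exchange_big; rewrite exchange_big. Qed.

Lemma xi_poly_sum3 (I J K : finType) (f : I -> J -> K -> 'I_m -> P)
    (g : I -> J -> K -> 'I_m -> 'I_m -> 'I_m -> P) :
  \sum_i \sum_j \sum_k (xi_poly1 (f i j k) + xi_poly3 (fun a b c => half * g i j k a b c)) =
  xi_poly1 (fun a => \sum_i \sum_j \sum_k f i j k a)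
  + xi_poly3 (fun a b c => half * \sum_i \sum_j \sum_k g i j k a b c).
Proof.
rewrite -xi_poly1_sum -scalar_xi_poly3 -xi_poly3_sum mulr_sumr -big_split.
apply: eq_bigr => i _; rewrite -xi_poly1_sum -xi_poly3_sum mulr_sumr -big_split.
apply: eq_bigr => j _; rewrite -xi_poly1_sum -xi_poly3_sum mulr_sumr -big_split.
by apply: eq_bigr => k _; rewrite /= scalar_xi_poly3.
Qed.

(** Of the three entries only [M (x mu) (y b)] depends on p. Its p-linear part produces the first
    term of the deformation of rho, and its bivector part a cubic form in xi. *)
Lemma block_trace_xxy : block_trace x_ x_ y_ =
  - (xi_poly1 (fun a => \sum_la rho_dot1 a la * pv la)
     + xi_poly3 (fun a b c => half * T_dot1 a b c)).
Proof.
transitivity (- \sum_mu \sum_nu \sum_b D mu nu * Bb nu b * S (rho b mu)).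
  rewrite -sumrN; apply: eq_bigr => mu _; rewrite -sumrN; apply: eq_bigr => nu _.
  rewrite -sumrN; apply: eq_bigr => b _.
  by rewrite jacobian_xx jacobian_xy jacobian_yx mulrNN mulrN.
congr (- _).
under eq_bigr do under eq_bigr do under eq_bigr do rewrite mul_poly1_bivector.
rewrite xi_poly_sum3; congr (_ + _).
  apply: eq_xi_poly1 => a; rewrite sum_rot3 /rho_dot1.
  under [RHS]eq_bigr do rewrite mulr_suml; rewrite [RHS]exchange_big; apply: eq_bigr => b _.
  under [RHS]eq_bigr do rewrite mulr_suml; rewrite [RHS]exchange_big; apply: eq_bigr => mu _.
  under [RHS]eq_bigr do rewrite mulr_suml; rewrite [RHS]exchange_big; apply: eq_bigr => nu _.
  by rewrite mulr_sumr mulr_suml; apply: eq_bigr => la _; ring.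
apply: eq_xi_poly3 => a b c; congr (_ * _); rewrite sum_rot3.
apply: eq_bigr => d _; apply: eq_bigr => mu _; apply: eq_bigr => nu _; ring.
Qed.

Local Notation dxiH mu a := (ext_map (Dx mu) (d_xi a H)).

Let jacobian_xyE mu b : M (x mu) (y b) = - \sum_a dxiH mu a * S (Ki a b).
Proof. exact: jacobian_y. Qed.

Let jacobian_ypE a nu : M (y a) (p nu) = dxiH nu a.
Proof. by rewrite /jacobian /= ext_map_d_xi. Qed.

(** The Jacobian of a Hamiltonian field is symmetric up to the symplectic form: the pp block is
    minus the transposed xx block, and the blocks of p, y correspond to those of x, y with the
    metric placed on the other factor. *)
Lemma block_trace_ypp : block_trace y_ p_ p_ = block_trace x_ x_ y_.
Proof.
rewrite block_trace_rot block_trace_rot {1}/block_trace exchange_big.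
apply: eq_bigr => mu _; apply: eq_bigr => nu _.
transitivity (- (D mu nu * \sum_a dxiH nu a * S (raised_rho a mu))).
  rewrite mulr_sumr -sumrN; apply: eq_bigr => a _.
  by rewrite jacobian_pp jacobian_py jacobian_ypE mulrN mulNr -mulrA ext_scalarC.
transitivity (D mu nu * \sum_b M (x nu) (y b) * S (rho b mu)); last first.
  rewrite mulr_sumr; apply: eq_bigr => b _.
  by rewrite jacobian_xx jacobian_yx mulrN !mulNr opprK mulrA.
(* [Ki] moves from the raised rho to the derivative of H, where it forms [M (x nu) (y b)]. *)
rewrite -mulrN; congr (_ * _).
under eq_bigr do rewrite /raised_rho raddf_sum mulr_sumr.
rewrite exchange_big -sumrN; apply: eq_bigr => b _ /=.
rewrite jacobian_xyE mulNr; congr (- _); rewrite mulr_suml; apply: eq_bigr => a _.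
by rewrite rmorphM mulrA.
Qed.

Let T_form b c := xi_poly1 (fun d => T b d c).

Let raised_T_form a b : xi_poly1 (fun d => raised_T a d b) = \sum_c S (Ki b c) * T_form a c.
Proof. by rewrite -xi_poly1_sum; apply: eq_bigr => c _; rewrite scalar_xi_poly1. Qed.

Let T_form_skew b c : T_form c b = - T_form b c.
Proof.
rewrite /T_form /xi_poly1 -sumrN; apply: eq_bigr => d _.
by rewrite -mulNr -raddfN (T_skew12 d c) (T_skew23 d b c) (T_skew12 b d) !opprK.
Qed.

(** [Ki] moves twice: from the yy block to the derivative of H, forming [M (x nu) (y c)], and from
    the raised rho to the yy block. Each move costs a sign, the first by the sign in the xy block,
    the second because the lowered yy block [T_form] is skew. *)
Lemma block_trace_ypy : block_trace y_ p_ y_ = block_trace x_ y_ y_.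
Proof.
pose E a b := xi_poly1 (fun d => raised_T a d b).
transitivity (\sum_nu \sum_b \sum_a dxiH nu a * E b a * S (raised_rho b nu)).
  rewrite /block_trace exchange_big; apply: eq_bigr => nu _; rewrite exchange_big.
  apply: eq_bigr => b _; apply: eq_bigr => a _.
  rewrite jacobian_ypE jacobian_py jacobian_yy mulrN mulrN mulNr opprK.
  by rewrite -mulrA -ext_scalarC mulrA.
transitivity (\sum_nu \sum_b \sum_c M (x nu) (y c) * E c b * S (rho b nu)); last first.
  apply: eq_bigr => nu _; rewrite exchange_big; apply: eq_bigr => b _.
  apply: eq_bigr => c _; by rewrite jacobian_yy jacobian_yx !mulrN !mulNr opprK.
apply: eq_bigr => nu _.
transitivity (- \sum_b \sum_c M (x nu) (y c) * T_form b c * S (raised_rho b nu)).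
  rewrite -sumrN; apply: eq_bigr => b _.
  rewrite -mulr_suml -[in RHS]mulr_suml -mulNr; congr (_ * _).
  under eq_bigr do rewrite /E raised_T_form mulr_sumr.
  rewrite exchange_big -sumrN; apply: eq_bigr => c _.
  rewrite jacobian_xyE mulNr opprK mulr_suml; apply: eq_bigr => a _.
  by rewrite mulrA.
rewrite exchange_big [RHS]exchange_big -sumrN; apply: eq_bigr => c _.
under eq_bigr do rewrite /raised_rho raddf_sum mulr_sumr.
rewrite exchange_big -sumrN; apply: eq_bigr => e _.
rewrite /E raised_T_form mulr_sumr mulr_suml -sumrN; apply: eq_bigr => b _ /=.
rewrite rmorphM T_form_skew mulrN mulNr opprK Ki_sym !mulrA.
by congr (_ * _); rewrite -!(mulrA (M _ _)); congr (_ * _); exact: ext_scalarC.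
Qed.

(** Among the remaining blocks this is the only one with an entry [M (x mu) (p nu)], a second
    x-derivative of H. The other two entries contract to the pairing of rho with rho, which is zero
    by isotropy. *)
Lemma block_trace_xpy : block_trace x_ p_ y_ = 0.
Proof.
rewrite /block_trace big1 // => mu _; rewrite big1 // => nu _.
under eq_bigr do rewrite jacobian_py jacobian_yx !mulrN mulNr opprK -mulrA -rmorphM.
rewrite -mulr_sumr -raddf_sum (_ : \sum_b _ = 0) ?raddf0 ?mulr0 //.
rewrite -[RHS](rho_null nu mu) exchange_big; apply: eq_bigr => b _.
by rewrite mulr_suml; apply: eq_bigr => a _; rewrite Ki_sym.
Qed.

Let contract_T d b (G : 'I_m -> P) :
  \sum_a raised_T a d b * \sum_c Ki a c * G c = \sum_c G c * raised2_T d b c.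
Proof.
under eq_bigr do rewrite mulr_sumr; rewrite exchange_big; apply: eq_bigr => c _.
rewrite /raised2_T exchange_big mulr_sumr; apply: eq_bigr => a _ /=.
rewrite /raised_T mulr_suml mulr_sumr; apply: eq_bigr => e _.
rewrite (Ki_sym a c) (T_skew12 d a) (T_skew23 d e a); ring.
Qed.

Lemma block_trace_xyy : block_trace x_ y_ y_ =
  - (xi_poly1 (fun a => \sum_la rho_dot2 a la * pv la)
     + xi_poly3 (fun a b c => half * T_dot2 a b c)).
Proof.
transitivity (- \sum_mu \sum_a \sum_b
    Bb mu a * xi_poly1 (fun d => raised_T a d b) * S (rho b mu)).
  rewrite -sumrN; apply: eq_bigr => mu _; rewrite -sumrN; apply: eq_bigr => a _.
  rewrite -sumrN; apply: eq_bigr => b _.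
  by rewrite jacobian_yy jacobian_xy jacobian_yx mulrNN mulrN.
congr (- _).
under eq_bigr do under eq_bigr do under eq_bigr do rewrite mul_bivector_poly1.
(* Here the bivector stands to the left of the yy entry, so the free index of [raised2_T] comes
   last; a cyclic shift, an even permutation, makes it the first index of [T_dot2]. *)
rewrite xi_poly_sum3 -(xi_poly3_cycle (fun a b c => half * T_dot2 a b c)); congr (_ + _).
  apply: eq_xi_poly1 => d.
  under eq_bigr do rewrite exchange_big.
  rewrite exchange_big; under [RHS]eq_bigr do rewrite mulr_suml.
  rewrite [RHS]exchange_big; apply: eq_bigr => b _ /=.
  transitivity (\sum_la \sum_mu (rho b mu * \sum_c Dx mu (rho c la) * raised2_T d b c) * pv la).
    rewrite [RHS]exchange_big; apply: eq_bigr => mu _ /=.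
    under [RHS]eq_bigr do rewrite -contract_T !mulr_sumr mulr_suml.
    rewrite [RHS]exchange_big; apply: eq_bigr => a _.
    rewrite mulr_sumr mulr_suml; apply: eq_bigr => la _.
    rewrite (deriv_sum (DxD mu)); under [in LHS]eq_bigr do rewrite DxM Dx_Ki mul0r add0r.
    by ring.
  apply: eq_bigr => la _; rewrite -mulr_suml; congr (_ * _).
  rewrite exchange_big; apply: eq_bigr => mu _; rewrite mulr_sumr.
  by apply: eq_bigr => c _; rewrite mulrA.
apply: eq_xi_poly3 => a b c; congr (_ * _).
under eq_bigr do rewrite exchange_big.
rewrite exchange_big; apply: eq_bigr => d _ /=.
rewrite [RHS]exchange_big; apply: eq_bigr => mu _ /=.
transitivity (rho d mu * \sum_e Dx mu (T a b e) * raised2_T c d e).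
  rewrite -contract_T mulr_sumr; apply: eq_bigr => e _.
  rewrite (deriv_sum (DxD mu)); under [in LHS]eq_bigr do rewrite DxM Dx_Ki mul0r add0r.
  by ring.
by rewrite mulr_sumr; apply: eq_bigr => e _; ring.
Qed.

(** * Identification of the cube trace with the deformation *)

Definition P_alt3 (F : 'I_m -> 'I_m -> 'I_m -> P) a b c : P :=
  sixth * (F a b c + F b c a + F c a b - F b a c - F a c b - F c b a).

Lemma xi_poly3_alt F : xi_poly3 (P_alt3 F) = xi_poly3 F.
Proof.
rewrite -scalar_xi_poly3 -!xi_poly3D !xi_poly3N.
rewrite -(xi_poly3_cycle (fun a b c => F b c a)) (xi_poly3_cycle F).
rewrite (xi_poly3_swap12 F) (xi_poly3_swap23 F) (xi_poly3_rev F) !opprK.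
rewrite -[X in S _ * X](_ : xi_poly3 F *+ 6 = _); last by rewrite !mulrS addr0 !addrA.
by rewrite mulrnAr -mulrnAl -raddfMn sixthE /= rmorph1 mul1r.
Qed.

Definition cubic_T_dot a b c : P :=
  rho_chain a b c
  - (\sum_mu \sum_nu \sum_la Dx mu (rho a la) * Dx nu (rho b mu) * Dx la (rho c nu))
  - (\sum_d \sum_e \sum_f raised2_T a d e * T b d f * raised_T c e f)
  + 3%:R * P_alt3 T_dot1 a b c + 3%:R * P_alt3 T_dot2 a b c.

Definition cubic_deformation : B :=
  xi_poly1 (fun a => \sum_mu (rho_dot1 a mu + rho_dot2 a mu) * pv mu)
  + xi_poly3 (fun a b c => sixth * cubic_T_dot a b c).

Let contract2_T a b e f :
  \sum_d raised2_T a d e * T b d f = \sum_d raised_T a d e * raised_T f b d.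
Proof.
rewrite /raised2_T; under eq_bigr do rewrite mulr_suml.
rewrite exchange_big; apply: eq_bigr => d _; rewrite [raised_T f b d]/raised_T mulr_sumr.
apply: eq_bigr => c _; rewrite /raised_T !mulr_suml; apply: eq_bigr => g _.
rewrite (Ki_sym c d) (T_skew23 b f c) (T_skew12 f b c); ring.
Qed.

(** In a contracted pair the raised and the lowered index can be exchanged. This turns the product
    of three T into a cyclic chain, with b and c exchanged; the two signs from skewsymmetry
    cancel. *)
Lemma T_chainE a b c :
  \sum_d \sum_e \sum_f raised2_T a d e * T b d f * raised_T c e f = T_chain a c b.
Proof.
transitivity (\sum_e \sum_f (\sum_d raised2_T a d e * T b d f) * raised_T c e f).
  rewrite exchange_big; apply: eq_bigr => e _; rewrite exchange_big; apply: eq_bigr => f _.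
  by rewrite mulr_suml.
rewrite /T_chain [RHS]exchange_big; apply: eq_bigr => e _.
rewrite [RHS]exchange_big; apply: eq_bigr => f _.
rewrite contract2_T mulr_suml; apply: eq_bigr => d _ /=.
have sk i j k : raised_T i j k = - raised_T j i k.
  by rewrite /raised_T -sumrN; apply: eq_bigr => g _; rewrite (T_skew12 j i) mulrN.
rewrite (sk d) (sk e); ring.
Qed.

(** The second rho-term and the product of three T are chains with the last two free indices
    exchanged. In a cubic form this exchange costs a sign, which cancels the minus sign in front of
    them. *)
Lemma xi_poly3_cubic_T_dot : xi_poly3 cubic_T_dot = xi_poly3 rho_chain *+ 2 + xi_poly3 T_chain
  + xi_poly3 T_dot1 *+ 3 + xi_poly3 T_dot2 *+ 3.
Proof.
pose f1 a b c := - rho_chain a c b; pose f2 a b c := - T_chain a c b.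
have -> : xi_poly3 cubic_T_dot = xi_poly3 rho_chain + xi_poly3 f1 + xi_poly3 f2
    + S 3%:R * xi_poly3 (P_alt3 T_dot1) + S 3%:R * xi_poly3 (P_alt3 T_dot2).
  rewrite !scalar_xi_poly3 !xi_poly3D; apply: eq_xi_poly3 => a b c.
  rewrite /cubic_T_dot T_chainE /f1 /f2; congr (_ - _ - _ + _ + _).
  apply: eq_bigr => mu _; rewrite exchange_big; apply: eq_bigr => nu _.
  by apply: eq_bigr => la _; rewrite -!mulrA; congr (_ * _); rewrite mulrC.
rewrite !xi_poly3_alt /f1 /f2 !xi_poly3N.
rewrite (xi_poly3_swap23 rho_chain) (xi_poly3_swap23 T_chain) !opprK.
by rewrite !rmorph_nat !mulr_natl.
Qed.

(** The mixed classes occur three times each and are equal in pairs, hence the factor 6 on the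
    p-linear part; on the cubic part 6 meets [half] and leaves the 3 of [T_dot]. The words xxx and
    ppp together give the coefficient 2 of [rho_chain]. *)
Lemma cube_trace_cubic : cube_trace d X = - (cubic_deformation *+ 6).
Proof.
rewrite cube_trace_blocks block_trace_ypp block_trace_ypy block_trace_xpy.
rewrite block_trace_xxx block_trace_yyy block_trace_ppp block_trace_xxy block_trace_xyy.
rewrite /cubic_deformation -!scalar_xi_poly3 [X in S sixth * X]xi_poly3_cubic_T_dot.
have -> : xi_poly1 (fun a => \sum_mu (rho_dot1 a mu + rho_dot2 a mu) * pv mu) =
    xi_poly1 (fun a => \sum_mu rho_dot1 a mu * pv mu) +
    xi_poly1 (fun a => \sum_mu rho_dot2 a mu * pv mu).
  rewrite xi_poly1D; apply: eq_xi_poly1 => a.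
  by rewrite -big_split; apply: eq_bigr => mu _; rewrite mulrDl.
have s6 (f : B) : (S sixth * f) *+ 6 = f.
  by rewrite -mulrnAl -raddfMn sixthE /= rmorph1 mul1r.
rewrite [in RHS]mulrnDl s6.
apply: xicoefP => V; rewrite !mulrS !mulr0n.
rewrite !(xicoefD, xicoefN, xicoef0, xicoef_scalarM).
move: (half2 (xicoef (xi_poly3 T_dot1) V)) (half2 (xicoef (xi_poly3 T_dot2) V)).
move: (half * xicoef (xi_poly3 T_dot1) V) (half * xicoef (xi_poly3 T_dot2) V) => u v <- <-.
ring.
Qed.

Lemma bracket_cubic_deformation : ext_bracket H H = 0 ->
  ext_bracket H cubic_deformation = 0.
Proof.
move=> master; have := bracket_cube_trace cubic_hamiltonian_odd master.
rewrite cube_trace_cubic !ext_bracketE ?cubic_hamiltonian_odd //.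
set Q := vfield _ _ => e.
have QD f g : Q (f + g) = Q f + Q g by apply: vfieldD; exact: coord_derivD.
have Q0 : Q 0 = 0 by apply: (addrI (Q 0)); rewrite -QD !addr0.
have QN f : Q (- f) = - Q f by apply/eqP; rewrite -addr_eq0 -QD addNr Q0.
have e6 : Q cubic_deformation *+ 6 = 0.
  by rewrite -[RHS]oppr0 -e QN opprK !mulrS !mulr0n !QD Q0.
by rewrite -[LHS]mul1r -(rmorph1 (ext_scalar m)) -sixthE raddfMn mulrnAl -mulrnAr e6 mulr0.
Qed.

End CubicHamiltonian.
End PhaseSpace.

From mathcomp Require Import all_classical all_reals all_analysis.
From mathcomp Require Import -(notations) mpoly.
Import Order.TTheory Num.Theory numFieldNormedType.Exports.

(** * Functions smooth on an open set, and the symmetry of second derivatives *)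

Section SmoothFunctions.
Variables (R : realType) (n : nat) (U : set 'rV[R]_n).
Hypothesis openU : open U.
Implicit Types (u v w : 'rV[R]_n -> R) (mu nu : 'I_n).

Lemma open_near_eq u w x : (forall y, U y -> u y = w y) -> U x ->
  \forall y \near x, u y = w y.
Proof. by move=> uw Ux; exact: filterS uw (open_nbhs_nbhs (conj openU Ux)). Qed.

Lemma pd_eq_on mu u w : (forall y, U y -> u y = w y) ->
  forall x, U x -> pd mu u x = pd mu w x.
Proof.
move=> uw x Ux; apply: near_eq_derive.
exact: open_near_eq.
Qed.

Lemma continuous_eq_on u w x : (forall y, U y -> u y = w y) -> U x ->
  {for x, continuous u} -> {for x, continuous w}.
Proof.
move=> uw Ux cu; rewrite /prop_for /continuous_at -uw // => V /cu.
by apply: filterS2 (open_near_eq uw Ux) => y /= ->.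
Qed.

(** Coinduction for smoothness: a class of functions that are regular on U and whose partial
    derivatives stay in the class. Agreement on U suffices for the derivatives, because U is open
    and derivatives are local. *)
Lemma smooth_on_ind (Q : ('rV[R]_n -> R) -> Prop) :
  (forall u, Q u -> forall x, U x ->
     {for x, continuous u} /\ forall mu, derivable u x (delta_mx 0 mu)) ->
  (forall u mu, Q u -> exists2 w, Q w & forall x, U x -> pd mu u x = w x) ->
  forall u, Q u -> smooth_on U u.
Proof.
move=> Qreg Qpd u Qu s x Ux.
have [w Qw uw] : exists2 w, Q w & forall y, U y -> foldr (@pd R n) u s y = w y.
  elim: s => [|mu s [w Qw uw]]; first by exists u.
  have [w' Qw' ww'] := Qpd w mu Qw; exists w' => // y Uy.
  by rewrite /= (pd_eq_on mu uw) // ww'.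
have [cw dw] := Qreg w Qw x Ux; split=> [|mu].
  by apply: continuous_eq_on cw => // y Uy; rewrite uw.
apply: (near_eq_derivable _ (dw mu)).
by apply: open_near_eq => // y Uy; rewrite uw.
Qed.

Lemma smooth_on_reg u x : smooth_on U u -> U x ->
  {for x, continuous u} /\ forall mu, derivable u x (delta_mx 0 mu).
Proof. by move=> su; exact: (su [::]). Qed.

Lemma smooth_on_pd mu u : smooth_on U u -> smooth_on U (pd mu u).
Proof. by move=> su s x Ux; have := su (rcons s mu) x Ux; rewrite foldr_rcons. Qed.

Lemma smooth_on_eq u w : (forall x, U x -> u x = w x) -> smooth_on U u -> smooth_on U w.
Proof.
move=> uw su; apply: (smooth_on_ind (Q := fun v => exists2 v', smooth_on U v' &
    forall x, U x -> v x = v' x)); last by exists u => // x Ux; rewrite uw.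
  move=> v [v' sv' vv'] x Ux; have [cv dv] := smooth_on_reg sv' Ux; split=> [|mu].
    by apply: continuous_eq_on cv => // y Uy; rewrite vv'.
  apply: (near_eq_derivable _ (dv mu)).
  by apply: open_near_eq => // y Uy; rewrite vv'.
move=> v mu [v' sv' vv']; exists (pd mu v').
  by exists (pd mu v') => //; exact: smooth_on_pd.
exact: pd_eq_on.
Qed.

Lemma pdD mu u w x : smooth_on U u -> smooth_on U w -> U x ->
  pd mu (u + w) x = pd mu u x + pd mu w x.
Proof.
by move=> su sw Ux; apply: deriveD; [exact: (smooth_on_reg su Ux).2|exact: (smooth_on_reg sw Ux).2].
Qed.

Lemma pdM mu u w x : smooth_on U u -> smooth_on U w -> U x ->
  pd mu (u * w) x = pd mu u x * w x + u x * pd mu w x.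
Proof.
move=> su sw Ux; rewrite /pd deriveM;
  [|exact: (smooth_on_reg su Ux).2|exact: (smooth_on_reg sw Ux).2].
by rewrite addrC; congr (_ + _); rewrite -[LHS]/(w x * _) mulrC.
Qed.

Lemma pd_cst mu (c : R) x : pd mu (cst c) x = 0.
Proof. exact: derive_cst. Qed.

Lemma smooth_on_cst (c : R) : smooth_on U (cst c).
Proof.
apply: (smooth_on_ind (Q := fun v => exists c, v = cst c)); last by exists c.
  move=> _ [d ->] x _; split=> [|mu]; first exact: cst_continuous.
  exact: derivable_cst.
by move=> _ mu [d ->]; exists (cst 0); [exists 0|move=> x _; rewrite pd_cst].
Qed.

(** The derivative of a product is a sum of products, so products of smooth functions alone do not
    form a class to which [smooth_on_ind] applies; this closure does. *)
Inductive smooth_closure : ('rV[R]_n -> R) -> Prop :=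
| SmoothBase u of smooth_on U u : smooth_closure u
| SmoothAdd u w of smooth_closure u & smooth_closure w : smooth_closure (u + w)
| SmoothMul u w of smooth_closure u & smooth_closure w : smooth_closure (u * w).

Lemma smooth_closure_smooth u : smooth_closure u -> smooth_on U u.
Proof.
have reg v : smooth_closure v -> forall x, U x ->
     {for x, continuous v} /\ forall mu, derivable v x (delta_mx 0 mu).
  elim=> [{}v sv x|{}v w _ IHv _ IHw x Ux|{}v w _ IHv _ IHw x Ux].
  - exact: smooth_on_reg.
  - have [cv dv] := IHv x Ux; have [cw dw] := IHw x Ux; split=> [|mu].
      exact: (continuousD cv cw).
    exact: derivableD.
  - have [cv dv] := IHv x Ux; have [cw dw] := IHw x Ux; split=> [|mu].
      exact: (continuousM cv cw).
    exact: derivableM.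
apply: smooth_on_ind; first exact: reg.
move=> v mu; elim=> [{}v sv|{}v w sv [v' sv' vv'] sw [w' sw' ww']|
    {}v w sv [v' sv' vv'] sw [w' sw' ww']].
- by exists (pd mu v) => //; apply: SmoothBase; exact: smooth_on_pd.
- exists (v' + w'); first exact: SmoothAdd.
  move=> x Ux; rewrite -[RHS]/(v' x + w' x) -vv' // -ww' //.
  by apply: deriveD; [exact: (reg v sv x Ux).2|exact: (reg w sw x Ux).2].
- exists (v' * w + v * w').
    by apply: SmoothAdd; apply: SmoothMul.
  move=> x Ux; rewrite -[RHS]/(v' x * w x + v x * w' x) -vv' // -ww' //.
  rewrite /pd deriveM; [|exact: (reg v sv x Ux).2|exact: (reg w sw x Ux).2].
  by rewrite addrC; congr (_ + _); rewrite -[LHS]/(w x * _) mulrC.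
Qed.
Lemma is_derive_line u (y e : 'rV[R]_n) (s : R) : derivable u (s *: e + y) e ->
  is_derive s 1 (fun t : R => u (t *: e + y)) ('D_e u (s *: e + y)).
Proof.
have E : (fun h : R => h^-1 *: (((fun t : R => u (t *: e + y)) \o shift s) (h *: 1)
      - u (s *: e + y)))
    = (fun h : R => h^-1 *: ((u \o shift (s *: e + y)) (h *: e) - u (s *: e + y))).
  by apply/funext => h /=; rewrite [h *: 1]mulr1 scalerDl addrA.
by move=> du; apply: DeriveDef; rewrite /derivable /derive E.
Qed.

(** The mean value theorem twice: in direction mu for the increment of u along nu, then in direction
    nu for [pd mu u]. *)
Lemma second_difference mu nu u x h : smooth_on U u -> 0 < h ->
  (forall s t, 0 <= s <= h -> 0 <= t <= h ->
     U (s *: delta_mx 0 mu + (t *: delta_mx 0 nu + x))) ->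
  exists s t, [/\ 0 <= s <= h, 0 <= t <= h &
    u (h *: delta_mx 0 mu + (h *: delta_mx 0 nu + x)) - u (h *: delta_mx 0 nu + x)
      - u (h *: delta_mx 0 mu + x) + u x =
    pd nu (pd mu u) (s *: delta_mx 0 mu + (t *: delta_mx 0 nu + x)) * (h * h)].
Proof.
set e := delta_mx 0 mu; set e' := delta_mx 0 nu => su h0 box.
have h00 : (0 : R) <= 0 <= h by rewrite lexx ltW.
have hh : 0 <= h <= h by rewrite lexx ltW.
have itv s : s \in `]0, h[ -> 0 <= s <= h by rewrite in_itv => /andP[/ltW-> /ltW->].
have box0 s : 0 <= s <= h -> U (s *: e + x).
  by move=> hs; have := box s 0 hs h00; rewrite scale0r add0r.
pose f s := u (s *: e + (h *: e' + x)) - u (s *: e + x).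
have df s : 0 <= s <= h -> is_derive s 1 f
    (pd mu u (s *: e + (h *: e' + x)) - pd mu u (s *: e + x)).
  move=> hs; apply: is_deriveB; apply: is_derive_line.
    exact: (smooth_on_reg su (box s h hs hh)).2.
  exact: (smooth_on_reg su (box0 s hs)).2.
have [s /itv hs es] : exists2 s, s \in `]0, h[ & f h - f 0 =
    (pd mu u (s *: e + (h *: e' + x)) - pd mu u (s *: e + x)) * (h - 0).
  apply: (@MVT R f (fun s => pd mu u (s *: e + (h *: e' + x)) - pd mu u (s *: e + x)) 0 h h0).
    by move=> s /itv; exact: df.
  by apply: derivable_within_continuous => s; rewrite in_itv => hs; case: (df s hs).
pose g t := pd mu u (t *: e' + (s *: e + x)).
have dg t : 0 <= t <= h -> is_derive t 1 g (pd nu (pd mu u) (t *: e' + (s *: e + x))).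
  move=> ht; apply: is_derive_line; rewrite addrCA.
  exact: (smooth_on_reg (smooth_on_pd mu su) (box s t hs ht)).2.
have [t /itv ht et] : exists2 t, t \in `]0, h[ & g h - g 0 =
    pd nu (pd mu u) (t *: e' + (s *: e + x)) * (h - 0).
  apply: (@MVT R g (fun t => pd nu (pd mu u) (t *: e' + (s *: e + x))) 0 h h0).
    by move=> t /itv; exact: dg.
  by apply: derivable_within_continuous => t; rewrite in_itv => ht; case: (dg t ht).
exists s, t; split=> //; move: es et; rewrite /f /g !subr0 !scale0r !add0r.
rewrite (addrCA (h *: e')) (addrCA (t *: e')) => es et.
rewrite mulrA -et -es; ring.
Qed.

(** The second difference is symmetric in mu and nu, so the two mixed derivatives take equal values
    at two points of an arbitrarily small box at x; their continuity at x gives the equality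
    there. *)
Lemma pd_comm mu nu u x : smooth_on U u -> U x -> pd mu (pd nu u) x = pd nu (pd mu u) x.
Proof.
move=> su Ux; apply/eqP; rewrite -subr_eq0 -normr_le0.
apply/ler_addgt0Pr => eps eps0; rewrite add0r.
set e := delta_mx 0 mu : 'rV[R]_n; set e' := delta_mx 0 nu : 'rV[R]_n.
have cont al be : {for x, continuous (pd al (pd be u))}.
  exact: (smooth_on_reg (smooth_on_pd _ (smooth_on_pd _ su)) Ux).1.
have e2 : 0 < eps / 2 by rewrite divr_gt0.
have tri (a b z : R) : `|a - z| < eps / 2 -> `|b - z| < eps / 2 -> `|a - b| <= eps.
  move=> az bz; rewrite (splitr eps) (le_trans (ler_distD z _ _)) //.
  by rewrite lerD // ltW // distrC.
have near_x : \forall y \near x, [/\ U y,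
    `|pd mu (pd nu u) x - pd mu (pd nu u) y| < eps / 2 &
    `|pd nu (pd mu u) x - pd nu (pd mu u) y| < eps / 2].
  move/cvgr_dist_lt: (cont mu nu) => /(_ _ e2) n1; move/cvgr_dist_lt: (cont nu mu) => /(_ _ e2) n2.
  have n0 : \forall y \near x, U y by exact: open_nbhs_nbhs.
  have FF : Filter (nbhs x) by exact: nbhs_filter.
  apply: (@filterS3 _ _ FF _ _ _ _ _ n0 n1 n2) => y.
  exact: And3.
have [r /= r0 hr] := (nbhs_ballP _ _).1 near_x.
(* A box of side h lies within distance h * c = r / 2 of x; the summand 1 makes c visibly
   positive. *)
pose c := `|e| + `|e'| + 1.
have c0 : 0 < c by rewrite ltr_wpDl // addr_ge0.
pose h := r / 2 / c.
have h0 : 0 < h by rewrite !divr_gt0.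
have box (s t : R) : 0 <= s <= h -> 0 <= t <= h -> ball x r (s *: e + (t *: e' + x)).
  move=> /andP[s0 sh] /andP[t0 th]; rewrite -ball_normE /= addrA opprD addrCA subrr addr0.
  rewrite normrN (le_lt_trans (ler_normD _ _)) // !normrZ !ger0_norm //.
  apply: (@le_lt_trans _ _ (h * c)).
    rewrite /c !mulrDr mulr1 -[leLHS]addr0 lerD // ?(ltW h0) //.
    by rewrite lerD // ler_wpM2r.
  by rewrite /h divfK ?gt_eqF // ltr_pdivrMr // ltr_pMr // ltr1n.
have boxU s t hs ht := hr _ (box s t hs ht).
have [s [t [hs ht est]]] 
  := second_difference su h0 (fun s t hs ht => let: And3 Us _ _ := boxU s t hs ht in Us).
have boxU' s' t' : 0 <= s' <= h -> 0 <= t' <= h -> U (s' *: e' + (t' *: e + x)).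
  by move=> hs' ht'; rewrite addrCA; case: (boxU t' s' ht' hs').
have [s' [t' [hs' ht' est']]] := second_difference su h0 boxU'.
(* Both sides times h * h are the same second difference of u. *)
have E : pd nu (pd mu u) (s *: e + (t *: e' + x)) = pd mu (pd nu u) (s' *: e' + (t' *: e + x)).
  apply: (@mulIf _ (h * h)); first by rewrite mulf_neq0 // gt_eqF.
  apply: (etrans (esym est)); apply: (etrans _ est').
  rewrite [h *: e' + (h *: e + x)]addrCA.
  congr (_ + _); exact: addrAC.
case: (boxU s t hs ht) => _ _; rewrite E => d1.
case: (boxU t' s' ht' hs') => _; rewrite (addrCA (t' *: e)) => d2 _.
exact: tri d2 d1.
Qed.
End SmoothFunctions.

(** * The ring of functions smooth on U and its commuting derivations *)

Section SmoothRing.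
Variables (R : realType) (n : nat) (U : set 'rV[R]_n) (openU : open U).

(** The proof of openness is a parameter because the subring structure attached to this predicate
    depends on it. *)
Definition smooth_pred (_ : open U) : {pred 'rV[R]_n -> R} :=
  fun u => `[< smooth_on U u >].

Lemma smooth_subring_closed : subring_closed (smooth_pred openU).
Proof.
have c := smooth_closure_smooth openU; have b := @SmoothBase R n U.
have k (r : R) : smooth_on U (cst r) by exact: smooth_on_cst.
split=> [|u w /asboolP su /asboolP sw|u w /asboolP su /asboolP sw]; apply/asboolP.
- exact: k.
- have -> : u - w = u + cst (-1) * w.
    by apply/funext => x; rewrite -[RHS]/(u x + -1 * w x) mulN1r.
  by apply: c; apply: SmoothAdd; [exact: b|apply: SmoothMul; exact: b].
- by apply: c; apply: SmoothMul; exact: b.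
Qed.

HB.instance Definition _ := GRing.isSubringClosed.Build _ (smooth_pred openU)
  smooth_subring_closed.

Record smooth_fun := SmoothFun {
  smooth_val : 'rV[R]_n -> R; smooth_valP : smooth_val \in smooth_pred openU }.

HB.instance Definition _ := [isSub for smooth_val].
HB.instance Definition _ := [Choice of smooth_fun by <:].
HB.instance Definition _ := [SubChoice_isSubComNzRing of smooth_fun by <:].

Implicit Types u w : smooth_fun.

Lemma smooth_valD u w x : smooth_val (u + w) x = smooth_val u x + smooth_val w x.
Proof. by []. Qed.

Lemma smooth_valM u w x : smooth_val (u * w) x = smooth_val u x * smooth_val w x.
Proof. by []. Qed.

Lemma smooth_on_val u : smooth_on U (smooth_val u).
Proof. exact/asboolP/smooth_valP. Qed.

Lemma smooth_val_inj u w : (forall x, smooth_val u x = smooth_val w x) -> u = w.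
Proof. by move=> uw; apply/val_inj/funext. Qed.

(* Multiplication by the indicator of U is invisible on U and turns the
   equations that hold on U into equations in this ring. *)
Definition cut_fun (v : 'rV[R]_n -> R) : 'rV[R]_n -> R := fun x => (x \in U)%:R * v x.

Lemma cut_fun_smooth v : smooth_on U v -> cut_fun v \in smooth_pred openU.
Proof.
move=> sv; apply/asboolP; apply: smooth_on_eq sv => // x Ux.
by rewrite /cut_fun mem_set // mul1r.
Qed.

Definition smooth_cut v (sv : smooth_on U v) : smooth_fun := SmoothFun (cut_fun_smooth sv).

(** On U the usual rules for derivatives hold; off U the cut makes both sides of every rule zero. *)
Definition smooth_deriv mu u : smooth_fun := smooth_cut (smooth_on_pd mu (smooth_on_val u)).

(** Constants are not cut: the unit of the ring is the constant 1 on the whole space, and six times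
    the constant 1/6 has to equal it. *)
Definition smooth_cst (c : R) : smooth_fun :=
  SmoothFun (asboolT (smooth_on_cst openU c) : cst c \in smooth_pred openU).

Lemma smooth_cutE v (sv : smooth_on U v) x : U x -> smooth_val (smooth_cut sv) x = v x.
Proof. by move=> Ux; rewrite /= /cut_fun mem_set // mul1r. Qed.

Lemma smooth_cutE0 v (sv : smooth_on U v) x : ~ U x -> smooth_val (smooth_cut sv) x = 0.
Proof. by move=> Ux; rewrite /= /cut_fun memNset // mul0r. Qed.

Lemma smooth_derivE mu u x : U x -> smooth_val (smooth_deriv mu u) x = pd mu (smooth_val u) x.
Proof. exact: smooth_cutE. Qed.

Lemma smooth_derivD mu u w : smooth_deriv mu (u + w) = smooth_deriv mu u + smooth_deriv mu w.
Proof.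
apply: smooth_val_inj => x; rewrite smooth_valD.
have [Ux|nUx] := pselect (U x); last by rewrite !smooth_cutE0 // addr0.
rewrite !smooth_derivE //; exact: (pdD mu (smooth_on_val u) (smooth_on_val w)).

Qed.

Lemma smooth_derivM mu u w :
  smooth_deriv mu (u * w) = smooth_deriv mu u * w + u * smooth_deriv mu w.
Proof.
apply: smooth_val_inj => x; rewrite smooth_valD !smooth_valM.
have [Ux|nUx] := pselect (U x); last by rewrite !smooth_cutE0 // mul0r mulr0 addr0.
rewrite !smooth_derivE //; exact: (pdM mu (smooth_on_val u) (smooth_on_val w)).
Qed.

Lemma smooth_derivC mu nu u :
  smooth_deriv mu (smooth_deriv nu u) = smooth_deriv nu (smooth_deriv mu u).
Proof.
apply: smooth_val_inj => x.
have [Ux|nUx] := pselect (U x); last by rewrite !smooth_cutE0.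
have e al be : smooth_val (smooth_deriv al (smooth_deriv be u)) x =
    pd al (pd be (smooth_val u)) x.
  apply: (etrans (smooth_derivE _ _ Ux)); apply: (pd_eq_on openU) Ux => y Uy.
  exact: smooth_derivE.
rewrite !e; apply: (pd_comm openU) => //; exact: smooth_on_val.
Qed.

Lemma smooth_deriv_cst mu c : smooth_deriv mu (smooth_cst c) = 0.
Proof.
apply: smooth_val_inj => x; have [Ux|nUx] := pselect (U x); last by rewrite smooth_cutE0.
by rewrite smooth_derivE // pd_cst.
Qed.
End SmoothRing.

(** * Coefficientwise derivations of polynomials in p *)

Section MpolyDerivation.
Variables (n : nat) (A : comNzRingType) (D : {additive A -> A}).
Hypothesis DM : forall u v, D (u * v) = D u * v + u * D v.

Lemma map_mpoly_leibniz (p q : mpoly n A) :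
  map_mpoly D (p * q) = map_mpoly D p * q + p * map_mpoly D q.
Proof.
apply/mpolyP => k; rewrite mcoeff_map_mpoly mcoeffD !mcoeffM raddf_sum -big_split.
by apply: eq_bigr => i _; rewrite /= DM !mcoeff_map_mpoly.
Qed.

Lemma map_mpoly_mderiv i (p : mpoly n A) : map_mpoly D (mderiv i p) = mderiv i (map_mpoly D p).
Proof. by apply/mpolyP => k; rewrite mcoeff_map_mpoly !mcoeff_deriv mcoeff_map_mpoly raddfMn. Qed.

Lemma map_mpoly_derivX k : map_mpoly D (mpolyX A k : mpoly n A) = 0.
Proof.
have D1 : D 1 = 0.
  by apply: (addrI (D 1)); have := DM 1 1; rewrite !mulr1 mul1r addr0 => <-.
apply/mpolyP => j; rewrite mcoeff_map_mpoly mcoeffX mcoeff0.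
by case: eqP; rewrite ?D1 ?raddf0.
Qed.
End MpolyDerivation.

Lemma mderiv_mpolyX1 (n : nat) (A : comNzRingType) (i j : 'I_n) :
  mderiv i (mpolyX A (mnm1 j)) = (i == j)%:R.
Proof.
rewrite mderivX mnm1E eq_sym; case: eqP => [->|_]; last exact: scale0r.
by rewrite scale1r -[X in mnm_sub X]add0m addmK mpolyX0.
Qed.

(** * Agreement on U between the exact ring and [gfun] *)

Section Transport.
Variables (R : realType) (n m : nat) (U : set 'rV[R]_n) (openU : open U).

Local Notation A := (smooth_fun openU).
Local Notation F := ('rV[R]_n -> R).
Local Notation P := (mpoly n A).

Lemma smooth_deriv_is_nmod_morphism mu : nmod_morphism (smooth_deriv mu : A -> A).
Proof.
split=> [|u w]; last exact: smooth_derivD.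
by apply: (addrI (smooth_deriv mu (0 : A))); rewrite -smooth_derivD !addr0.
Qed.

HB.instance Definition _ mu := GRing.isNmodMorphism.Build A A (smooth_deriv mu)
  (smooth_deriv_is_nmod_morphism mu).

(** All operations in the bracket preserve this relation. It carries the master equation into the
    exact ring and the conclusion back. *)
Definition eq_on_poly (p : P) (q : mpoly n F) : Prop :=
  forall k x, U x -> smooth_val (mcoeff k p) x = mcoeff k q x.

Definition eq_on_ext (f : exterior P m) (g : gfun R n m) : Prop :=
  forall S, eq_on_poly (xicoef f S) (xicoef g S).

Lemma smooth_val_sum (I : Type) (r : seq I) (Q : pred I) (u : I -> A) x :
  smooth_val (\sum_(i <- r | Q i) u i) x = \sum_(i <- r | Q i) smooth_val (u i) x.
Proof. exact: (big_morph (fun v : A => smooth_val v x)). Qed.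

Lemma eq_on_poly0 : eq_on_poly 0 0.
Proof. by move=> k x _; rewrite !mcoeff0. Qed.

Lemma eq_on_polyD p q p' q' : eq_on_poly p q -> eq_on_poly p' q' ->
  eq_on_poly (p + p') (q + q').
Proof. by move=> h h' k x Ux; rewrite !mcoeffD smooth_valD h // h'. Qed.

Lemma eq_on_polyN p q : eq_on_poly p q -> eq_on_poly (- p) (- q).
Proof. by move=> h k x Ux; rewrite !mcoeffN -[RHS]/(- _) -h. Qed.

Lemma eq_on_polyM p q p' q' : eq_on_poly p q -> eq_on_poly p' q' ->
  eq_on_poly (p * p') (q * q').
Proof.
move=> h h' k x Ux; rewrite !mcoeffM smooth_val_sum fct_sumE.
by apply: eq_bigr => i _; rewrite smooth_valM h // h'.
Qed.

Lemma eq_on_poly_sum I (r : seq I) (Q : pred I) p q :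
  (forall i, Q i -> eq_on_poly (p i) (q i)) ->
  eq_on_poly (\sum_(i <- r | Q i) p i) (\sum_(i <- r | Q i) q i).
Proof.
by move=> h; elim/big_rec2: _ => [|i p' q' Qi]; [exact: eq_on_poly0|apply/eq_on_polyD/h].
Qed.

Lemma eq_on_poly_sign j p q : eq_on_poly p q ->
  eq_on_poly ((-1) ^+ j * p) ((-1) ^+ j * q).
Proof.
move=> h; rewrite -signr_odd -[in X in eq_on_poly _ X]signr_odd.
case: (odd j); first by rewrite !mulN1r; exact: eq_on_polyN.
by rewrite !mul1r.
Qed.

Lemma eq_on_polyC u v : (forall x, U x -> smooth_val u x = v x) ->
  eq_on_poly (mpolyC n u) (mpolyC n v).
Proof.
move=> h k x Ux; rewrite !mcoeffC; case: eqP => _; first by rewrite !mulr1; exact: h.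
by rewrite !mulr0.
Qed.

Lemma eq_on_poly_mderiv mu p q : eq_on_poly p q ->
  eq_on_poly (mderiv mu p) (mderiv mu q).
Proof.
move=> h k x Ux; rewrite !mcoeff_deriv.
elim: (k mu).+1 => [|j IH]; first by rewrite !mulr0n.
by rewrite !mulrS smooth_valD IH h.
Qed.

(** Meant for f = [pd mu], which is not additive on arbitrary functions. Each monomial occurs once
    in the support of q, so f 0 = 0 is enough. *)
Lemma mcoeff_map_mpoly0 (f : F -> F) (q : mpoly n F) k : f 0 = 0 ->
  mcoeff k (map_mpoly f q) = f (mcoeff k q).
Proof.
move=> f0; rewrite /map_mpoly /mmap raddf_sum /=.
under eq_bigr do rewrite mmap1_id mcoeffCM mcoeffX.
have [kq|kq] := boolP (k \in msupp q).
  rewrite (bigD1_seq k) ?msupp_uniq //= eqxx mulr1 big1 ?addr0 // => j /negPf jk.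
  by rewrite jk mulr0.
rewrite big_seq big1 => [|j jq]; last first.
  by case: eqP => [jk|_]; rewrite ?mulr0 //; move: kq; rewrite -jk jq.
by move: kq; rewrite -mcoeff_eq0 => /eqP ->.
Qed.
Definition poly_dx mu : P -> P := map_mpoly (smooth_deriv mu : A -> A).

Definition poly_dp mu : P -> P := mderiv mu.

Lemma mcoeff_poly_dx mu p k : mcoeff k (poly_dx mu p) = smooth_deriv mu (mcoeff k p).
Proof. exact: mcoeff_map_mpoly. Qed.

Lemma poly_dxC mu nu p : poly_dx mu (poly_dx nu p) = poly_dx nu (poly_dx mu p).
Proof.
have e al be k : mcoeff k (poly_dx al (poly_dx be p)) =
    smooth_deriv al (smooth_deriv be (mcoeff k p)).
  by rewrite mcoeff_poly_dx; congr smooth_deriv; exact: mcoeff_poly_dx.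
apply/mpolyP => k; apply: (etrans (e mu nu k)); apply: (etrans (smooth_derivC _ _ _)).
exact: (esym (e nu mu k)).
Qed.

Lemma eq_on_poly_dx mu p q : eq_on_poly p q ->
  eq_on_poly (poly_dx mu p) (map_mpoly (pd mu) q).
Proof.
move=> h k x Ux; rewrite mcoeff_map_mpoly0; last by apply/funext => y; exact: pd_cst.
rewrite mcoeff_poly_dx; apply: (etrans (smooth_derivE _ _ Ux)).
by apply: (pd_eq_on openU) Ux; exact: h.
Qed.

Lemma eq_on_extD f g f' g' : eq_on_ext f g -> eq_on_ext f' g' ->
  eq_on_ext (f + f') (g + g').
Proof. by move=> h h' S; rewrite !xicoefD; apply: eq_on_polyD. Qed.

Lemma eq_on_extN f g : eq_on_ext f g -> eq_on_ext (- f) (- g).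
Proof. by move=> h S; rewrite !xicoefN; apply: eq_on_polyN. Qed.

Lemma eq_on_ext_sum I (r : seq I) (Q : pred I) f g :
  (forall i, Q i -> eq_on_ext (f i) (g i)) ->
  eq_on_ext (\sum_(i <- r | Q i) f i) (\sum_(i <- r | Q i) g i).
Proof. by move=> h S; rewrite !xicoef_sum; apply: eq_on_poly_sum => i Qi; exact: h. Qed.

Lemma eq_on_extM f g f' g' : eq_on_ext f g -> eq_on_ext f' g' ->
  eq_on_ext (f * f') (g * g').
Proof.
move=> h h' S; rewrite !xicoefM; apply: eq_on_poly_sum => V _.
by apply/eq_on_poly_sign/eq_on_polyM; [exact: h|exact: h'].
Qed.

Lemma eq_on_ext_scalar p q : eq_on_poly p q ->
  eq_on_ext (ext_scalar m p) (ext_scalar m q).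
Proof. by move=> h S; rewrite !xicoef_scalar; case: ifP => // _; exact: eq_on_poly0. Qed.

Lemma eq_on_poly_nat j : eq_on_poly j%:R j%:R.
Proof.
elim: j => [|j IH]; first exact: eq_on_poly0.
rewrite !mulrS; apply: eq_on_polyD IH => k x _; rewrite !mcoeff1.
by case: eqP.
Qed.

Lemma eq_on_ext_xi a : eq_on_ext (xi P a) (xivar R n a).
Proof. by move=> S; rewrite !xicoef_mk; exact: eq_on_poly_nat. Qed.

Lemma eq_on_ext_dx mu f g : eq_on_ext f g ->
  eq_on_ext (ext_map (poly_dx mu) f) (dx mu g).
Proof. by move=> h S; rewrite !xicoef_mk; apply/eq_on_poly_dx/h. Qed.

Lemma eq_on_ext_dp mu f g : eq_on_ext f g ->
  eq_on_ext (ext_map (poly_dp mu) f) (dp mu g).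
Proof. by move=> h S; rewrite !xicoef_mk; apply/eq_on_poly_mderiv/h. Qed.

Lemma eq_on_ext_dxi a f g : eq_on_ext f g -> eq_on_ext (d_xi a f) (dxi a g).
Proof.
move=> h S; rewrite !xicoef_d_xi; case: ifP => _; first exact: eq_on_poly0.
exact/eq_on_poly_sign/h.
Qed.

Lemma eq_on_ext_grade_inv f g : eq_on_ext f g ->
  eq_on_ext (grade_inv f) (grade_inv g).
Proof. by move=> h S; rewrite !xicoef_mk; exact/eq_on_poly_sign/h. Qed.

Definition poly_cst (c : R) : P := mpolyC n (smooth_cst openU c).

Lemma eq_on_ext_bracket (K : 'M[R]_m) f g f' g' : eq_on_ext f g -> eq_on_ext f' g' ->
  eq_on_ext (ext_bracket poly_dx poly_dp (fun a b => poly_cst (invmx K a b)) f f')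
    (pbracket K g g').
Proof.
move=> h h'; apply: eq_on_extD.
  apply: eq_on_ext_sum => mu _; apply: eq_on_extD.
    by apply: eq_on_extM; [exact: eq_on_ext_dx|exact: eq_on_ext_dp].
  by apply/eq_on_extN/eq_on_extM; [exact: eq_on_ext_dp|exact: eq_on_ext_dx].
apply: eq_on_ext_sum => a _; apply: eq_on_ext_sum => b _.
apply: eq_on_extM; last exact: eq_on_ext_dxi.
apply: eq_on_extM; first exact/eq_on_ext_dxi/eq_on_ext_grade_inv.
by apply: eq_on_ext_scalar; exact: eq_on_polyC.
Qed.

Definition eq_on_fun (p : P) (v : F) : Prop := eq_on_poly p (mpolyC n v).

Lemma eq_on_funD p v q w : eq_on_fun p v -> eq_on_fun q w -> eq_on_fun (p + q) (v + w).
Proof. by rewrite /eq_on_fun raddfD; exact: eq_on_polyD. Qed.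

Lemma eq_on_funN p v : eq_on_fun p v -> eq_on_fun (- p) (- v).
Proof. by rewrite /eq_on_fun raddfN; exact: eq_on_polyN. Qed.

Lemma eq_on_funM p v q w : eq_on_fun p v -> eq_on_fun q w -> eq_on_fun (p * q) (v * w).
Proof. by rewrite /eq_on_fun rmorphM; exact: eq_on_polyM. Qed.

Lemma eq_on_fun_sum I (r : seq I) (Q : pred I) p v :
  (forall i, Q i -> eq_on_fun (p i) (v i)) ->
  eq_on_fun (\sum_(i <- r | Q i) p i) (\sum_(i <- r | Q i) v i).
Proof. by rewrite /eq_on_fun raddf_sum; exact: eq_on_poly_sum. Qed.

Lemma eq_on_funZ c p v : eq_on_fun p v -> eq_on_fun (poly_cst c * p) (c *: v).
Proof.
move=> h; rewrite (_ : c *: v = cst c * v); last exact/funext.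
by apply: eq_on_funM h; exact: eq_on_polyC.
Qed.

Lemma eq_on_fun_dx mu p v : eq_on_fun p v -> eq_on_fun (poly_dx mu p) (pd mu v).
Proof.
move=> h k x Ux; have := eq_on_poly_dx mu h k Ux.
rewrite mcoeff_map_mpoly0 ?mcoeffC => [->|]; last by apply/funext => y; exact: pd_cst.
case: eqP => _; first by rewrite !mulr1.
by rewrite !mulr0; exact: pd_cst.
Qed.

Lemma eq_on_fun_nat j : eq_on_fun j%:R j%:R.
Proof. by rewrite /eq_on_fun rmorph_nat; exact: eq_on_poly_nat. Qed.
End Transport.

(** * The data, the Hamiltonian and its deformation in both settings *)

Section DeformationTransport.
Variables (R : realType) (n m : nat) (U : set 'rV[R]_n) (openU : open U).
Variables (K : 'M[R]_m) (rho : 'I_m -> 'I_n -> 'rV[R]_n -> R).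
Variable T : 'I_m -> 'I_m -> 'I_m -> 'rV[R]_n -> R.
Hypothesis rho_smooth : forall a mu, smooth_on U (rho a mu).
Hypothesis T_smooth : forall a b c, smooth_on U (T a b c).

Local Notation A := (smooth_fun openU).
Local Notation P := (mpoly n A).
Local Notation sim := eq_on_fun.

Definition ring_Ki a b : P := poly_cst openU (invmx K a b).
Definition ring_sixth : P := poly_cst openU 6%:R^-1.
Definition ring_p mu : P := mpolyX A (mnm1 mu).
Definition ring_rho a mu : P := mpolyC n (smooth_cut openU (rho_smooth a mu)).
Definition ring_T a b c : P := mpolyC n (smooth_cut openU (T_smooth a b c)).

Local Notation Dx := (@poly_dx R n U openU).
Local Notation Ki := ring_Ki.

Lemma eq_on_ring_rho a mu : sim (ring_rho a mu) (rho a mu).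
Proof. by apply: eq_on_polyC => x; exact: smooth_cutE. Qed.

Lemma eq_on_ring_T a b c : sim (ring_T a b c) (T a b c).
Proof. by apply: eq_on_polyC => x; exact: smooth_cutE. Qed.

Lemma eq_on_raised_rho b mu : sim (raised_rho Ki ring_rho b mu) (rho_up K rho b mu).
Proof. by apply: eq_on_fun_sum => c _; apply/eq_on_funZ/eq_on_ring_rho. Qed.

Lemma eq_on_raised_T a b c : sim (raised_T Ki ring_T a b c) (T_up3 K T a b c).
Proof. by apply: eq_on_fun_sum => d _; apply/eq_on_funZ/eq_on_ring_T. Qed.

Lemma eq_on_raised2_T a b c : sim (raised2_T Ki ring_T a b c) (T_up23 K T a b c).
Proof.
apply: eq_on_fun_sum => d _; apply: eq_on_fun_sum => e _.
by rewrite -mulrA -scalerA; apply/eq_on_funZ/eq_on_funZ/eq_on_ring_T.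
Qed.

Lemma eq_on_rho_dot a mu :
  sim (rho_dot1 Dx Ki ring_rho a mu + rho_dot2 Dx Ki ring_rho ring_T a mu)
    (rho_dot K rho T a mu).
Proof.
apply: eq_on_funD.
  apply: eq_on_fun_sum => b _; apply: eq_on_fun_sum => la _; apply: eq_on_fun_sum => nu _.
  apply: eq_on_funM; last exact/eq_on_fun_dx/eq_on_raised_rho.
  by apply: eq_on_funM; [|apply: eq_on_fun_dx]; exact: eq_on_ring_rho.
apply: eq_on_fun_sum => b _; apply: eq_on_fun_sum => c _; apply: eq_on_fun_sum => la _.
apply: eq_on_funM; last exact: eq_on_raised2_T.
by apply: eq_on_funM; [|apply: eq_on_fun_dx]; exact: eq_on_ring_rho.
Qed.

Lemma eq_on_alt3 (F : 'I_m -> 'I_m -> 'I_m -> P) (G : 'I_m -> 'I_m -> 'I_m -> 'rV[R]_n -> R)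
    a b c : (forall a b c, sim (F a b c) (G a b c)) ->
  sim (P_alt3 ring_sixth F a b c) (alt3 G a b c).
Proof.
move=> FG; apply: eq_on_funZ.
by do 3!(apply: eq_on_funD; last exact: eq_on_funN); do 2!apply: eq_on_funD => //.
Qed.

Lemma eq_on_cubic_T_dot a b c : sim (cubic_T_dot Dx Ki ring_rho ring_T ring_sixth a b c)
  (T_dot K rho T a b c).
Proof.
have drho mu d nu : sim (Dx mu (ring_rho d nu)) (pd mu (rho d nu)).
  exact/eq_on_fun_dx/eq_on_ring_rho.
apply: eq_on_funD; first (apply: eq_on_funD; first (apply: eq_on_funD; first apply: eq_on_funD)).
- apply: eq_on_fun_sum => mu _; apply: eq_on_fun_sum => nu _; apply: eq_on_fun_sum => la _.
  by apply: eq_on_funM => //; apply: eq_on_funM.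
- apply: eq_on_funN.
  apply: eq_on_fun_sum => mu _; apply: eq_on_fun_sum => nu _; apply: eq_on_fun_sum => la _.
  by apply: eq_on_funM => //; apply: eq_on_funM.
- apply: eq_on_funN.
  apply: eq_on_fun_sum => d _; apply: eq_on_fun_sum => e _; apply: eq_on_fun_sum => f _.
  apply: eq_on_funM; last exact: eq_on_raised_T.
  by apply: eq_on_funM; [exact: eq_on_raised2_T|exact: eq_on_ring_T].
- apply: eq_on_funM; first exact: eq_on_fun_nat.
  apply: eq_on_alt3 => a' b' c'.
  apply: eq_on_fun_sum => d _; apply: eq_on_fun_sum => mu _; apply: eq_on_fun_sum => nu _.
  apply: eq_on_funM; last exact/eq_on_fun_dx/eq_on_raised_T.
  by apply: eq_on_funM => //; exact: eq_on_ring_rho.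
- apply: eq_on_funM; first exact: eq_on_fun_nat.
  apply: eq_on_alt3 => a' b' c'.
  apply: eq_on_fun_sum => d _; apply: eq_on_fun_sum => e _; apply: eq_on_fun_sum => mu _.
  apply: eq_on_funM; last exact/eq_on_fun_dx/eq_on_ring_T.
  by apply: eq_on_funM; [exact: eq_on_ring_rho|exact: eq_on_raised2_T].
Qed.

(** Stated for general components so as to cover both H and its deformation. *)
Lemma eq_on_hamiltonian (r : 'I_m -> 'I_n -> P) (t : 'I_m -> 'I_m -> 'I_m -> P) r0 t0 :
  (forall a mu, sim (r a mu) (r0 a mu)) -> (forall a b c, sim (t a b c) (t0 a b c)) ->
  eq_on_ext (xi_poly1 (fun a => \sum_mu r a mu * ring_p mu)
    + xi_poly3 (fun a b c => ring_sixth * t a b c)) (hamiltonian r0 t0).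
Proof.
move=> rr tt; apply: eq_on_extD.
  apply: eq_on_ext_sum => a _; rewrite raddf_sum mulr_suml; apply: eq_on_ext_sum => mu _ /=.
  rewrite rmorphM -mulrA -(ext_scalarC (ring_p mu)) mulrA; apply: eq_on_extM.
    by apply: eq_on_extM; [apply: eq_on_ext_scalar; exact: rr|exact: eq_on_ext_xi].
  apply: eq_on_ext_scalar => k x Ux; rewrite !mcoeffX.
  by case: eqP.
apply: eq_on_ext_sum => a _; apply: eq_on_ext_sum => b _; apply: eq_on_ext_sum => c _.
rewrite /= !mulrA; do 3!(apply: eq_on_extM; last exact: eq_on_ext_xi).
by apply: eq_on_ext_scalar; exact: eq_on_funZ.
Qed.
End DeformationTransport.

(** * The exact master equation and the conclusion on U *)

Section ExactPhaseSpace.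
Variables (R : realType) (n m : nat) (U : set 'rV[R]_n) (openU : open U).
Variables (K : 'M[R]_m) (rho : 'I_m -> 'I_n -> 'rV[R]_n -> R).
Variable T : 'I_m -> 'I_m -> 'I_m -> 'rV[R]_n -> R.
Hypothesis K_sym : K^T = K.
Hypothesis rho_smooth : forall a mu, smooth_on U (rho a mu).
Hypothesis T_smooth : forall a b c, smooth_on U (T a b c).
Hypothesis T_skew : skew3_on U T.

Local Notation A := (smooth_fun openU).
Local Notation P := (mpoly n A).
Local Notation Dx := (@poly_dx R n U openU).
Local Notation Dp := (@poly_dp R n U openU).
Local Notation Ki := (ring_Ki openU K).
Local Notation rrho := (ring_rho openU rho_smooth).
Local Notation rT := (ring_T openU T_smooth).
Local Notation sixth := (ring_sixth openU).
Local Notation pv := (@ring_p R n U openU).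
Local Notation H := (cubic_hamiltonian pv rrho rT sixth).

Let DxD mu (u v : P) : Dx mu (u + v) = Dx mu u + Dx mu v.
Proof. exact: raddfD. Qed.

Let DpD mu (u v : P) : Dp mu (u + v) = Dp mu u + Dp mu v.
Proof. exact: mderivD. Qed.

Let DxM mu (u v : P) : Dx mu (u * v) = Dx mu u * v + u * Dx mu v.
Proof. exact/map_mpoly_leibniz/smooth_derivM. Qed.

Let DpM mu (u v : P) : Dp mu (u * v) = Dp mu u * v + u * Dp mu v.
Proof. exact: mderivM. Qed.

Let DxC mu nu (u : P) : Dx mu (Dx nu u) = Dx nu (Dx mu u).
Proof. exact: poly_dxC. Qed.

Let DpC mu nu (u : P) : Dp mu (Dp nu u) = Dp nu (Dp mu u).
Proof. exact: mderiv_comm. Qed.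

Let DxpC mu nu (u : P) : Dx mu (Dp nu u) = Dp nu (Dx mu u).
Proof. exact: map_mpoly_mderiv. Qed.

Let Dx_C mu (u : A) : Dx mu (mpolyC n u) = mpolyC n (smooth_deriv mu u).
Proof. exact: map_mpolyC. Qed.

Let Dp_C mu (u : A) : Dp mu (mpolyC n u) = 0.
Proof. exact: mderivC. Qed.

Let Dx_cst mu c : Dx mu (poly_cst openU c) = 0.
Proof. by rewrite Dx_C smooth_deriv_cst mpolyC0. Qed.

Let torsion2P (u : P) : u + u = 0 -> u = 0.
Proof.
move=> uu; apply/mpolyP => k; apply: smooth_val_inj => x; rewrite mcoeff0.
have := congr1 (fun p => smooth_val (mcoeff k p) x) uu.
by rewrite mcoeffD smooth_valD mcoeff0 => /eqP; rewrite -mulr2n mulrn_eq0 => /eqP.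
Qed.

Let Ki_sym a b : Ki a b = Ki b a.
Proof.
have e : (invmx K)^T = invmx K by rewrite trmx_inv K_sym.
by rewrite /ring_Ki -[in LHS]e mxE.
Qed.

Let smooth_val_mulrn (u : A) j x : smooth_val (u *+ j) x = smooth_val u x *+ j.
Proof. by elim: j => [|j IH]; rewrite ?mulr0n // !mulrS smooth_valD IH. Qed.

Let sixthE : sixth *+ 6 = 1.
Proof.
rewrite -raddfMn -[RHS](rmorph1 (@mpolyC n A)); congr (mpolyC n _).
apply: smooth_val_inj => x; rewrite smooth_val_mulrn.
by rewrite -[RHS]/(1 : R) -[smooth_val _ x]/(6%:R^-1 : R) -[LHS]mulr_natr mulVf // pnatr_eq0.
Qed.

Let rT_skew12 a b c : rT b a c = - rT a b c.
Proof.
rewrite -raddfN; congr (mpolyC n _); apply: smooth_val_inj => x.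
rewrite -[RHS]/(- smooth_val (smooth_cut openU (T_smooth a b c)) x).
have [Ux|nUx] := pselect (U x); last by rewrite !smooth_cutE0 // oppr0.
by rewrite !smooth_cutE //; exact: (T_skew a b c Ux).1.
Qed.

Let rT_skew23 a b c : rT a c b = - rT a b c.
Proof.
rewrite -raddfN; congr (mpolyC n _); apply: smooth_val_inj => x.
rewrite -[RHS]/(- smooth_val (smooth_cut openU (T_smooth a b c)) x).
have [Ux|nUx] := pselect (U x); last by rewrite !smooth_cutE0 // oppr0.
by rewrite !smooth_cutE //; exact: (T_skew a b c Ux).2.
Qed.

(** The indicator function of U: it is killed by the derivations and acts as a unit on all cut
    functions, hence on H. *)
Let unitU : A := smooth_cut openU (smooth_on_cst openU 1).

Let unitU_cut v (sv : smooth_on U v) : unitU * smooth_cut openU sv = smooth_cut openU sv.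
Proof.
apply: smooth_val_inj => x; rewrite smooth_valM.
have [Ux|nUx] := pselect (U x); last by rewrite !smooth_cutE0 // mulr0.
by rewrite [smooth_val unitU x]smooth_cutE // mul1r.
Qed.

Let unitU_deriv mu : smooth_deriv mu unitU = 0.
Proof.
apply: smooth_val_inj => x.
have [Ux|nUx] := pselect (U x); last by rewrite smooth_cutE0.
apply: (etrans (smooth_derivE _ _ Ux)); apply: (etrans _ (pd_cst mu 1 x)).
by apply: (pd_eq_on openU) Ux => y; exact: smooth_cutE.
Qed.

Let unitU_H : ext_scalar m (mpolyC n unitU) * H = H.
Proof.
have e v (sv : smooth_on U v) :
    mpolyC n unitU * mpolyC n (smooth_cut openU sv) = mpolyC n (smooth_cut openU sv).
  by rewrite -[in RHS]unitU_cut; exact/esym/rmorphM.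
by apply: scalar_cubic_hamiltonian => *; exact: e.
Qed.

(** At points of U this is the given master equation, by agreement on U. *)
Lemma ring_master : eq0_on U (pbracket K (hamiltonian rho T) (hamiltonian rho T)) ->
  ext_bracket Dx Dp Ki H H = 0.
Proof.
move=> master.
have simH : eq_on_ext H (hamiltonian rho T).
  by apply: eq_on_hamiltonian => *; [exact: eq_on_ring_rho|exact: eq_on_ring_T].
apply: xicoefP => V; apply/mpolyP => k; apply: smooth_val_inj => x.
have [Ux|nUx] := pselect (U x).
  apply: (etrans (eq_on_ext_bracket K simH simH V k Ux)).
  by rewrite master // xicoef0 mcoeff0.
(* At points off U: the bracket is a multiple of the indicator function, because H is and the
   derivations kill that function. *)
have -> : ext_bracket Dx Dp Ki H H = ext_scalar m (mpolyC n unitU) * ext_bracket Dx Dp Ki H H.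
  rewrite -[X in ext_bracket _ _ _ X _ = _]unitU_H; apply: ext_bracketMl => // mu.
  by rewrite Dx_C unitU_deriv mpolyC0.
rewrite xicoef_scalarM mcoeffCM smooth_valM [smooth_val unitU x]smooth_cutE0 // mul0r.
by rewrite xicoef0 mcoeff0.
Qed.

Lemma bracket_deformation_on :
  eq0_on U (pbracket K (hamiltonian rho T) (hamiltonian rho T)) ->
  eq0_on U (pbracket K (hamiltonian rho T) (hamiltonian (rho_dot K rho T) (T_dot K rho T))).
Proof.
move=> /ring_master master V k x Ux.
have simH : eq_on_ext H (hamiltonian rho T).
  by apply: eq_on_hamiltonian => *; [exact: eq_on_ring_rho|exact: eq_on_ring_T].
have simHdot : eq_on_ext (cubic_deformation Dx Ki pv rrho rT sixth)
    (hamiltonian (rho_dot K rho T) (T_dot K rho T)).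
  by apply: eq_on_hamiltonian => *; [exact: eq_on_rho_dot|exact: eq_on_cubic_T_dot].
have Dx_Ki mu a b : Dx mu (Ki a b) = 0 by exact: Dx_cst.
have Dp_Ki mu a b : Dp mu (Ki a b) = 0 by exact: Dp_C.
have Dx_pv mu nu : Dx mu (pv nu) = 0 by exact: (map_mpoly_derivX (smooth_derivM _)).
have Dp_pv mu nu : Dp mu (pv nu) = (mu == nu)%:R by exact: mderiv_mpolyX1.
have Dx_sixth mu : Dx mu sixth = 0 by exact: Dx_cst.
have Dp_sixth mu : Dp mu sixth = 0 by exact: Dp_C.
have Dp_rho mu a nu : Dp mu (rrho a nu) = 0 by exact: Dp_C.
have Dp_T mu a b c : Dp mu (rT a b c) = 0 by exact: Dp_C.
apply: (etrans (esym (eq_on_ext_bracket K simH simHdot V k Ux))).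
have rho_null mu nu : \sum_a \sum_b Ki a b * rrho a mu * rrho b nu = 0.
  exact: (master_rho_null DxD DpD DpM Ki_sym Dp_Ki torsion2P Dp_sixth Dp_pv Dp_rho Dp_T).
have -> := bracket_cubic_deformation DxD DpD DxM DpM DxC DpC DxpC Ki_sym Dx_Ki Dp_Ki
  torsion2P sixthE Dx_sixth Dp_sixth Dx_pv Dp_pv Dp_rho Dp_T rT_skew12 rT_skew23 rho_null master.
by rewrite xicoef0 mcoeff0.
Qed.
End ExactPhaseSpace.

Theorem mainTheorem8 (R : realType) (n m : nat) (U : set 'rV[R]_n)
    (kappa : 'M[R]_m)
    (rho : 'I_m -> 'I_n -> 'rV[R]_n -> R)
    (T : 'I_m -> 'I_m -> 'I_m -> 'rV[R]_n -> R)
    (openU : open U)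
    (kappa_sym : kappa^T = kappa) (kappa_inv : kappa \in unitmx)
    (rho_smooth : forall a mu, smooth_on U (rho a mu))
    (T_smooth : forall a b c, smooth_on U (T a b c))
    (T_skew : skew3_on U T)
    (master : eq0_on U (pbracket kappa (hamiltonian rho T) (hamiltonian rho T))) :
  eq0_on U (pbracket kappa (hamiltonian rho T)
    (hamiltonian (rho_dot kappa rho T) (T_dot kappa rho T))).
Proof.
exact: (bracket_deformation_on openU kappa_sym rho_smooth T_smooth T_skew).
Qed.
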